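(* Let $\mathcal{K}$ be a class of interval orders for which there is a polynomial $p$ such that $|\mathcal{E}_P|\le p(|X|)$ for every $P=(X,\prec)\in\mathcal{K}$. Then there is an algorithm that, given $P=(X,\prec)\in\mathcal{K}$, computes the unique minimal (integral) Hilbert basis of the pointed cone $Q_P^*$ in time polynomial in $|X|$.
   Context: A finite (strictly) partially ordered set $P=(X,\prec)$, $X=\{1,\dots,n\}$, is an interval order if there are compact real intervals $[\ell_x,r_x]$, $x\in X$, with $\ell_x\le r_x$, such that $x\prec y$ if and only if $r_x<\ell_y$. Interval representations are moreover required to satisfy $r_x+1\le \ell_y$ for all $x\prec y$. A natural representation is one in which all endpoints are non-negative integers. The magnitude $m$ of $P$ is the number of distinct down-sets $D(z)=\{x: x\prec z\}$, $z\in X$. The canonical representation of $P$ is the (unique) natural representation whose set of interval endpoints is $\{0,1,\dots,m-1\}$. The length polyhedron $Q_P\subset\mathbb{R}^n$ is the set of all vectors $(r_x-\ell_x)_{x\in X}$ over all interval representations of $P$ with real endpoints (satisfying $r_x+1\le\ell_y$ for all $x\prec y$). Let $\boldsymbol{\rho^*}$ be the vector of interval lengths of the canonical representation. Then $Q_P=\boldsymbol{\rho^*}+Q_P^*$, where $Q_P^*=\{v-\boldsymbol{\rho^*}: v\in Q_P\}$ is a pointed rational cone. Let $[\ell_x,r_x]$, $x\in X$, now denote the intervals of the canonical representation. For $1\le i\le m-1$ the $i$th gap set is $\mathcal{G}_i=\{x\in X:\ell_x\le i-1\text{ and } i\le r_x\}$, and $\mathcal{G}_0=\mathcal{G}_m=\varnothing$.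 For $0\le i\le m$ the left- and right-borderline sets are $\mathcal{L}_i=\{x\in X: r_x=i-1\}$ and $\mathcal{R}_i=\{x\in X:\ell_x=i\}$. A non-empty set $S\subseteq X$ is a fundamental extender if there are an index $0\le i\le m$ and a set $Z$ with $Z\subseteq\mathcal{L}_i$ or $Z\subseteq\mathcal{R}_i$ such that $S=\mathcal{G}_i\cup Z$. $\mathcal{E}_P$ is the collection of all fundamental extenders of $P$. An integral Hilbert basis of a polyhedral cone is a finite set of integral vectors of the cone such that each integral vector in the cone is a non-negative integral linear combination of vectors from this set. A pointed rational cone has a unique (inclusion-)minimal integral Hilbert basis. *)

(* Defs.v *)
From Corelib Require Import BinNums.
From mathcomp Require Import all_boot all_order all_algebra finmap.
From mathcomp Require Import boolp classical_sets reals.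

Set Implicit Arguments.
Unset Strict Implicit.
Unset Printing Implicit Defensive.
Import Order.TTheory GRing.Theory Num.Theory.

Local Open Scope ring_scope.

(** ** Interval orders and their representations *)

(* An order on X = {1, ..., n} is a relation [lt] on 'I_n (shifted to start
   at 0).  Being irreflexive and transitive follows from [interval_order]. *)

Definition interval_order (R : realType) n (lt : rel 'I_n) : Prop :=
  exists l r : 'I_n -> R,
    (forall x, l x <= r x) /\ (forall x y, lt x y <-> r x < l y).

Definition interval_rep (R : realType) n (lt : rel 'I_n)
    (l r : 'I_n -> R) : Prop :=
  [/\ forall x, l x <= r x,
      forall x y, lt x y <-> r x < l y
    & forall x y, lt x y -> r x + 1 <= l y].

(* On nat the requirement r x + 1 <= l y is literally r x < l y. *)
Definition natural_rep n (lt : rel 'I_n) (l r : 'I_n -> nat) : Prop :=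
  (forall x, (l x <= r x)%N) /\ (forall x y, lt x y <-> (r x < l y)%N).

Definition down_set n (lt : rel 'I_n) (z : 'I_n) : {set 'I_n} :=
  [set x | lt x z]%SET.

Definition magnitude n (lt : rel 'I_n) : nat :=
  #|[set down_set lt z | z in 'I_n]%SET|.

Definition canonical_rep n (lt : rel 'I_n) (l r : 'I_n -> nat) : Prop :=
  natural_rep lt l r /\
  forall k : nat,
    (exists x, l x = k \/ r x = k) <-> (k < magnitude lt)%N.

(* The canonical representation as a pair (left, right) of endpoint functions.
   It exists and is unique for interval orders; the default (0, 0) of [xget]
   only matters for other relations. *)
Definition canonical n (lt : rel 'I_n) :
    {ffun 'I_n -> nat} * {ffun 'I_n -> nat} :=
  xget ([ffun=> 0%N], [ffun=> 0%N])
    [set lr : {ffun 'I_n -> nat} * {ffun 'I_n -> nat} |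
       canonical_rep lt lr.1 lr.2]%classic.

Definition cleft n (lt : rel 'I_n) (x : 'I_n) : nat := (canonical lt).1 x.
Definition cright n (lt : rel 'I_n) (x : 'I_n) : nat := (canonical lt).2 x.

(** ** The length polyhedron *)

Definition length_polyhedron (R : realType) n (lt : rel 'I_n) :
    set 'rV[R]_n :=
  [set v | exists l r : 'I_n -> R,
     interval_rep lt l r /\ v = \row_x (r x - l x)]%classic.
Arguments length_polyhedron R {n} lt _.

Definition rho_star (R : realType) n (lt : rel 'I_n) : 'rV[R]_n :=
  \row_x ((cright lt x)%:R - (cleft lt x)%:R).

Definition length_cone (R : realType) n (lt : rel 'I_n) : set 'rV[R]_n :=
  [set v - rho_star R lt | v in length_polyhedron R lt]%classic.
Arguments length_cone R {n} lt _.

(** ** Fundamental extenders *)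

Definition gap_set n (lt : rel 'I_n) (i : nat) : {set 'I_n} :=
  if (0 < i < magnitude lt)%N
  then [set x | (cleft lt x <= i.-1)%N && (i <= cright lt x)%N]%SET
  else finset.set0.

(* r x = i - 1 is written r x + 1 = i to avoid truncated subtraction at 0. *)
Definition left_borderline n (lt : rel 'I_n) (i : nat) : {set 'I_n} :=
  [set x | (cright lt x).+1 == i]%SET.

Definition right_borderline n (lt : rel 'I_n) (i : nat) : {set 'I_n} :=
  [set x | cleft lt x == i]%SET.

Definition extenders n (lt : rel 'I_n) : {set {set 'I_n}} :=
  [set S : {set 'I_n} | (S != finset.set0) &&
    [exists i : 'I_(magnitude lt).+1, exists Z : {set 'I_n},
       ((Z \subset left_borderline lt i) || (Z \subset right_borderline lt i))
       && (S == gap_set lt i :|: Z)]]%SET.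

(** ** Integral Hilbert bases *)

Definition hilbert_basis (R : realType) n (C : set 'rV[R]_n)
    (H : {fset 'rV[int]_n}) : Prop :=
  (forall h, h \in H -> C (map_mx intr h)) /\
  (forall z : 'rV[int]_n, C (map_mx intr z) ->
     exists c : 'rV[int]_n -> nat, z = \sum_(h <- H) h *+ c h).

Definition minimal_hilbert_basis (R : realType) n (C : set 'rV[R]_n)
    (H : {fset 'rV[int]_n}) : Prop :=
  hilbert_basis C H /\
  forall H' : {fset 'rV[int]_n},
    hilbert_basis C H' -> (H' `<=` H)%fset -> H' = H.

(** ** Model of computation *)

(* Algorithms are programs of the language WHILE of N. D. Jones (Computability
   and Complexity from a Programming Perspective, 1997), which computes on
   binary trees with one leaf symbol, under his unit-cost time measure (trees
   are shared, so that an assignment does not copy).  Programs simulate, and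
   are simulated by, Turing machines with polynomial overhead. *)

Inductive tree : Type := Leaf | Node of tree & tree.

Definition left_subtree (t : tree) : tree := if t is Node a _ then a else Leaf.
Definition right_subtree (t : tree) : tree := if t is Node _ b then b else Leaf.
Definition is_node (t : tree) : bool := if t is Node _ _ then true else false.

Inductive expr : Type :=
  | Var of nat
  | Empty
  | Pair of expr & expr
  | Hd of expr
  | Tl of expr.

Inductive cmd : Type :=
  | Assign of nat & expr
  | Then of cmd & cmd
  | If of expr & cmd & cmd
  | While of expr & cmd.

Definition store := nat -> tree.

Definition update (s : store) (v : nat) (t : tree) : store :=
  fun w => if w == v then t else s w.

Fixpoint eval (s : store) (e : expr) : tree :=
  match e with
  | Var v => s v
  | Empty => Leaf
  | Pair a b => Node (eval s a) (eval s b)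
  | Hd a => left_subtree (eval s a)
  | Tl a => right_subtree (eval s a)
  end.

Fixpoint eval_time (e : expr) : nat :=
  match e with
  | Var _ | Empty => 1
  | Pair a b => (eval_time a + eval_time b).+1
  | Hd a | Tl a => (eval_time a).+1
  end%N.

(* [exec c s t s']: started in store s, the command c halts in store s' after
   t units of time. *)
Inductive exec : cmd -> store -> nat -> store -> Prop :=
  | ExecAssign v e s :
      exec (Assign v e) s (eval_time e).+1 (update s v (eval s e))
  | ExecThen c1 c2 s1 s2 s3 t1 t2 :
      exec c1 s1 t1 s2 -> exec c2 s2 t2 s3 ->
      exec (Then c1 c2) s1 (t1 + t2).+1 s3
  | ExecIfTrue e c1 c2 s t s' :
      is_node (eval s e) -> exec c1 s t s' ->
      exec (If e c1 c2) s (eval_time e + t).+1 s'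
  | ExecIfFalse e c1 c2 s t s' :
      ~~ is_node (eval s e) -> exec c2 s t s' ->
      exec (If e c1 c2) s (eval_time e + t).+1 s'
  | ExecWhileTrue e c s1 s2 s3 t1 t2 :
      is_node (eval s1 e) -> exec c s1 t1 s2 -> exec (While e c) s2 t2 s3 ->
      exec (While e c) s1 (eval_time e + t1 + t2).+1 s3
  | ExecWhileFalse e c s :
      ~~ is_node (eval s e) ->
      exec (While e c) s (eval_time e).+1 s.

(* Input and output are both held in variable 0; the other variables are
   initially empty. *)
Definition computes_in (c : cmd) (input output : tree) (t : nat) : Prop :=
  exists s' : store,
    exec c (update (fun=> Leaf) 0 input) t s' /\ s' 0%N = output.

(** ** Encoding of inputs and outputs *)

Definition encode_bool (b : bool) : tree := if b then Node Leaf Leaf else Leaf.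

Definition encode_seq (T : Type) (encode : T -> tree) (s : seq T) : tree :=
  foldr (fun x t => Node (encode x) t) Leaf s.

(* Binary digits, least significant first. *)
Fixpoint bits_of_pos (k : positive) : seq bool :=
  match k with
  | xH => [:: true]
  | xO k' => false :: bits_of_pos k'
  | xI k' => true :: bits_of_pos k'
  end.

Definition bits_of_nat (k : nat) : seq bool :=
  if bin_of_nat k is Npos q then bits_of_pos q else [::].

Definition encode_int (z : int) : tree :=
  Node (encode_bool (z < 0)) (encode_seq encode_bool (bits_of_nat `|z|%N)).

Definition encode_vector n (v : 'rV[int]_n) : tree :=
  encode_seq (fun x => encode_int (v 0 x)) (enum 'I_n).

(* The n x n incidence matrix of the order, as a list of rows. *)
Definition encode_order n (lt : rel 'I_n) : tree :=
  encode_seq (fun x => encode_seq (fun y => encode_bool (lt x y)) (enum 'I_n))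
    (enum 'I_n).

(* Main.v *)
(* Cut a natural representation into unit steps [t, t+1] and collect the
   elements whose interval contains the step. Each such slice is empty or a
   fundamental extender, every gap set occurs as a slice, and the gap sets sum up
   to the lengths of the canonical representation; hence every integral vector of
   the cone is a sum of indicators of fundamental extenders. These indicators
   lie in the cone, because lengthening by an extender inserts a new point into
   the canonical representation. The minimal Hilbert basis thus consists of the
   indicators of those extenders which are not disjoint unions of others, and it
   is enough to test unions of two: among three disjoint extenders with a common
   point, two have a union that is again an extender. The extenders can be listed
   by comparing the up-sets, and dually the down-sets, of the elements, at a cost
   polynomial in n and their number. *)

(* The size of intermediate results is the obstacle to polynomial time. The sets Z are listed by
   prolonging bit vectors one element at a time; each element has at least one admissible bit, so no
   partial list is longer than the complete one, whose members are distinct extenders and possibly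
   the empty set. With X = n + |E| + 2, where E is the set of extenders, every program runs in time
   C * X^k for an explicit C, and a loop raises k by one. The program never computes the canonical
   representation. Each of its m points is both a left and a right endpoint, so inclusions between
   up-sets (down-sets) compare right (left) endpoints exactly. Minimality rests on a rigidity of 0/1
   vectors: a sum of indicators that equals the indicator of S partitions S. Expanding that
   indicator over any Hilbert basis and refining every term into extenders therefore yields a
   partition of S into extenders, which merging would shrink to two parts unless it has only one
   part. *)
Require Import Defs.
From mathcomp Require Import all_boot all_order all_algebra finmap.
From mathcomp Require Import boolp classical_sets reals.
From mathcomp Require Import zify lra.

Set Implicit Arguments.
Unset Strict Implicit.
Unset Printing Implicit Defensive.
Import Order.TTheory GRing.Theory Num.Theory.

Local Open Scope ring_scope.

(** * Time-bounded composition of WHILE programs *)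

Section Combinators.
Local Open Scope nat_scope.

(* [p b d] finds its d inputs in the variables b, ..., b+d-1, puts its result in
   variable b+d, and may overwrite all later variables. *)
Definition prog := nat -> nat -> cmd.

(** Variables outside the frame become [Empty], in agreement with the default [Leaf] of [nth] in
    [evals]. *)
Fixpoint shift (b d : nat) (e : expr) : expr :=
  match e with
  | Var v => if v < d then Var (b + v) else Defs.Empty
  | Defs.Empty => Defs.Empty
  | Pair e1 e2 => Pair (shift b d e1) (shift b d e2)
  | Hd e1 => Hd (shift b d e1)
  | Tl e1 => Tl (shift b d e1)
  end.

Definition evals (env : seq tree) (e : expr) : tree := eval (nth Leaf env) e.

Definition holds_env (b : nat) (env : seq tree) (s : store) : Prop :=
  forall i, i < size env -> s (b + i) = nth Leaf env i.

(** Quantifying over the base and the whole store makes programs relocatable and indifferent to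
    garbage in later variables; the frame condition on earlier variables is what allows nesting. *)
Variant runs (p : prog) (env : seq tree) (out : tree) (c : nat) : Prop :=
  Runs of forall b s, holds_env b env s ->
    exists t s', [/\ exec (p b (size env)) s t s', t <= c,
      s' (b + size env) = out & forall i, i < b + size env -> s' i = s i].

Lemma eval_shift b env s e : holds_env b env s ->
  eval s (shift b (size env) e) = evals env e.
Proof.
move=> Hs; rewrite /evals; elim: e => [v||a IHa e IHe|a IHa|a IHa] /=;
  rewrite ?IHa ?IHe //.
by case: ltnP => [/Hs //|?]; rewrite nth_default.
Qed.

Lemma eval_time_shift b d e : eval_time (shift b d e) = eval_time e.
Proof. by elim: e => [v||a IHa e IHe|a IHa|a IHa] /=; rewrite ?IHa ?IHe //;
  case: ifP. Qed.

Lemma holds_env_eq b env s s' : holds_env b env s ->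
  (forall i, i < b + size env -> s' i = s i) -> holds_env b env s'.
Proof. by move=> Hs E i Hi; rewrite E ?Hs // ltn_add2l. Qed.

Lemma updateE s v t w : update s v t w = if w == v then t else s w.
Proof. by []. Qed.

Lemma update_ne s v t w : w != v -> update s v t w = s w.
Proof. by rewrite updateE => /negbTE ->. Qed.

Lemma update_same s v t : update s v t v = t.
Proof. by rewrite updateE eqxx. Qed.

Lemma runs_weaken c p env out c' : runs p env out c -> c <= c' ->
  runs p env out c'.
Proof.
case=> H le; split=> b s /H[t [s' [? ? ? ?]]]; exists t, s'; split => //.
exact: leq_trans le.
Qed.

Definition Ret (e : expr) : prog := fun b d => Assign (b + d) (shift b d e).

Lemma runs_ret env e : runs (Ret e) env (evals env e) (eval_time e).+1.
Proof.
split=> b s Hs; eexists; eexists; split; first exact: ExecAssign.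
- by rewrite eval_time_shift.
- by rewrite update_same eval_shift.
- by move=> i Hi; rewrite update_ne // neq_ltn Hi.
Qed.

(** The result of p lands where q, with one more input, expects its last input. The overhead 4 is
    the final copy (2) and two sequencings. *)
Definition Let (p q : prog) : prog := fun b d =>
  Then (p b d) (Then (q b d.+1) (Assign (b + d) (Var (b + d).+1))).

Lemma runs_let p q env x y cp cq :
  runs p env x cp -> runs q (rcons env x) y cq ->
  runs (Let p q) env y (cp + cq + 4).
Proof.
case=> Hp [Hq]; split=> b s Hs; have [t1 [s1 [e1 l1 r1 f1]]] := Hp b s Hs.
have Hs1 : holds_env b (rcons env x) s1.
  move=> i; rewrite size_rcons ltnS leq_eqVlt nth_rcons => /predU1P[->|Hi].
    by rewrite ltnn eqxx.
  by rewrite Hi (holds_env_eq Hs f1).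
have [t2 [s2 [e2 l2 r2 f2]]] := Hq b s1 Hs1.
rewrite size_rcons in e2 r2 f2.
do 2!eexists; split.
- by apply: ExecThen e1 _; apply: ExecThen e2 _; exact: ExecAssign.
- rewrite /=; lia.
- by rewrite update_same /= -addnS.
- move=> i Hi; rewrite update_ne ?neq_ltn ?Hi // f2 ?f1 //.
  by rewrite addnS ltnS ltnW.
Qed.

Fixpoint set_args (b d k : nat) (args : seq expr) (c : cmd) : cmd :=
  if args is e :: args' then
    Then (Assign (b + d + k) (shift b d e)) (set_args b d k.+1 args' c)
  else c.

(** The arguments are copied to a fresh frame above the current one, so the callee is written
    without regard to the environment of the caller. *)
Definition Call (p : prog) (args : seq expr) : prog := fun b d =>
  set_args b d 0 args
    (Then (p (b + d) (size args)) (Assign (b + d) (Var (b + d + size args)))).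

(** The assignments are nested around the final command c, hence the conclusion in terms of an
    arbitrary continuation; [done] holds the arguments already stored. *)
Lemma exec_set_args b env done args s :
  holds_env b env s ->
  (forall i, i < size done -> s (b + size env + i) = nth Leaf done i) ->
  exists s1, [/\ holds_env (b + size env) (done ++ map (evals env) args) s1,
    forall i, i < b + size env -> s1 i = s i &
    forall c t s', exec c s1 t s' ->
      exec (set_args b (size env) (size done) args c) s
        (t + sumn (map (fun e => (eval_time e).+2) args)) s'].
Proof.
elim: args done s => [|e args IH] done s Hs Hd /=.
  by exists s; split => [||c t s' H]; rewrite ?cats0 ?addn0.
pose s0 := update s (b + size env + size done) (evals env e).
have E0 i : i < b + size env + size done -> s0 i = s i.
  by move=> Hi; rewrite /s0 update_ne // neq_ltn Hi.
have E0' i : i < b + size env -> s0 i = s i.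
  by move=> Hi; apply: E0; rewrite ltn_addr.
have [||s1 [H1 H2 H3]] := IH (rcons done (evals env e)) s0.
- exact: holds_env_eq Hs E0'.
- move=> i; rewrite size_rcons ltnS leq_eqVlt nth_rcons => /predU1P[->|Hi].
    by rewrite ltnn eqxx /s0 update_same.
  by rewrite Hi E0 ?Hd // ltn_add2l.
exists s1; split.
- by rewrite cat_rcons in H1.
- by move=> i Hi; rewrite H2 ?E0'.
move=> c t s' /H3; rewrite size_rcons => {}H3.
have -> : t + ((eval_time e).+2 + sumn [seq (eval_time e0).+2 | e0 <- args])
   = ((eval_time e).+1 + (t + sumn [seq (eval_time e0).+2 | e0 <- args])).+1.
  by lia.
apply: ExecThen H3; rewrite /s0 -(eval_shift e Hs) -(eval_time_shift b (size env)).
exact: ExecAssign.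
Qed.

Lemma runs_call p args env x c :
  runs p (map (evals env) args) x c ->
  runs (Call p args) env x
    (c + sumn (map (fun e => (eval_time e).+2) args) + 3).
Proof.
case=> Hp; split=> b s Hs.
have [//|s1 [H1 H2 H3]] := @exec_set_args b env [::] args s Hs.
have [t [s2 [e2 l2 r2 f2]]] := Hp _ _ H1.
rewrite size_map in e2 r2 f2.
do 2!eexists; split.
- by apply: H3; apply: ExecThen e2 _; exact: ExecAssign.
- rewrite /=; lia.
- by rewrite update_same.
- move=> i Hi; rewrite update_ne ?neq_ltn ?Hi // f2 ?H2 //.
  by rewrite ltn_addr.
Qed.

Definition Cond (e : expr) (p q : prog) : prog := fun b d =>
  If (shift b d e) (p b d) (q b d).

Lemma runs_cond e p q env x c :
  (if is_node (evals env e) then runs p env x c else runs q env x c) ->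
  runs (Cond e p q) env x (eval_time e + c).+1.
Proof.
move=> H; split=> b s Hs; rewrite /Cond.
case: ifPn H => He [H]; have [t [s' [e1 l1 r1 f1]]] := H b s Hs;
  exists (eval_time e + t).+1, s'; split => //; rewrite ?ltnS ?leq_add2l //;
  rewrite -(eval_time_shift b (size env)).
- by apply: ExecIfTrue => //; rewrite (eval_shift e Hs).
- by apply: ExecIfFalse => //; rewrite (eval_shift e Hs).
Qed.

Lemma exec_time c s t t' s' : exec c s t s' -> t = t' -> exec c s t' s'.
Proof. by move=> H <-. Qed.

(* Besides the current element (variable d+1) and the accumulator (d+2), the
   body sees the list of the elements still to come (d). *)
Definition Loop (e init : expr) (p : prog) : prog := fun b d =>
  let v i := (b + d + i)%N in
  Then (Assign (v 0) (shift b d e))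
 (Then (Assign (v 2) (shift b d init))
 (Then (While (Var (v 0))
     (Then (Assign (v 1) (Hd (Var (v 0))))
     (Then (Assign (v 0) (Tl (Var (v 0))))
     (Then (p b (d + 3))
       (Assign (v 2) (Var (v 3)))))))
   (Assign (v 0) (Var (v 2))))).

(* [st p r] is the accumulator once the elements of p (last one first) have
   been processed and those of r remain. *)
Lemma runs_loop (T : Type) (enc : T -> tree) (l : seq T)
    (st : seq T -> seq T -> tree) e init p env B :
  evals env e = encode_seq enc l -> evals env init = st [::] l ->
  (forall q x r, l = catrev q (x :: r) ->
     runs p (env ++ [:: encode_seq enc r; enc x; st q (x :: r)])
       (st (x :: q) r) B) ->
  runs (Loop e init p) env (st (rev l) [::])
    (size l * (B + 13) + eval_time e + eval_time init + 10).
Proof.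
move=> El Ei Hp; split=> b s Hs; rewrite /Loop; set d := size env.
pose v i := b + d + i.
have vE i j : (v i == v j) = (i == j) by rewrite /v eqn_add2l.
have v_ge i j : i < b + d -> (i == v j) = false.
  by move=> Hi; apply/negbTE; rewrite neq_ltn /v (leq_trans Hi) ?leq_addr.
set W := While _ _.
(* One round costs 13 beyond the body: 3 + 3 + 2 for the assignments, 3 for sequencing, 2 for the
   test. The last, failing test costs 2. *)
have loop : forall r q s0, l = catrev q r -> holds_env b env s0 ->
    s0 (v 0) = encode_seq enc r -> s0 (v 2) = st q r ->
  exists t s', [/\ exec W s0 t s', t <= size r * (B + 13) + 2,
    s' (v 2) = st (rev l) [::] & forall i, i < b + d -> s' i = s0 i].
  elim=> [|x r IH] q s0 lE H0 E0 E2.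
    exists 2, s0; split=> //.
      by apply: (@ExecWhileFalse (Var (v 0))) => /=; rewrite E0.
    by rewrite lE -/(rev q) revK.
  pose s1 := update s0 (v 1) (enc x).
  pose s2 := update s1 (v 0) (encode_seq enc r).
  have f2 i : i < b + d -> s2 i = s0 i.
    by move=> Hi; rewrite /s2 /s1 !updateE !v_ge.
  have Hs2 : holds_env b (env ++ [:: encode_seq enc r; enc x; st q (x :: r)]) s2.
    move=> i; rewrite size_cat nth_cat /= => Hi'; case: ltnP => Hi.
      by rewrite f2 ?ltn_add2l // H0.
    have -> : b + i = v (i - size env) by rewrite /v /d; lia.
    have : i - size env < 3 by rewrite /d; lia.
    rewrite /s2 /s1 !updateE !vE.
    by case: (i - size env) => [|[|[|]]].
  have [t [s3 [e3 l3 r3 f3]]] := let: Runs h := Hp _ _ _ lE in h b s2 Hs2.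
  rewrite size_cat addnA in e3 r3 f3.
  pose s4 := update s3 (v 2) (st (x :: q) r).
  have f4 i : i < b + d -> s4 i = s0 i.
    by move=> Hi; rewrite /s4 updateE v_ge // f3 ?f2 // ltn_addr.
  have [||||t' [s5 [e5 l5 r5 f5]]] := IH (x :: q) s4.
  - by rewrite lE.
  - exact: holds_env_eq H0 f4.
  - rewrite /s4 updateE vE /= f3; first by rewrite /s2 update_same.
    by rewrite /v ltn_add2l.
  - by rewrite /s4 update_same.
  exists (t + t' + 13), s5; split => //; last first.
  - by move=> i Hi; rewrite f5 ?f4.
  - by rewrite /= mulSn; lia.
  apply: exec_time.
    apply: ExecWhileTrue e5; first by rewrite /= -/(v 0) E0.
    apply: ExecThen; first exact: ExecAssign.
    rewrite /= -/(v 0) -/(v 1) E0 /= -/s1.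
    apply: ExecThen; first exact: ExecAssign.
    have -> : update s1 (b + d + 0) (eval s1 (Tl (Var (b + d + 0)))) = s2.
      by rewrite /= -/(v 0) /s2 {2}/s1 updateE vE E0.
    apply: ExecThen; first exact: e3.
    have -> : s4 = update s3 (v 2) (eval s3 (Var (v 3))).
      by rewrite /s4 /= -r3 /v /d.
    exact: ExecAssign.
  by rewrite /=; lia.
pose s1 := update s (v 0) (encode_seq enc l).
pose s2 := update s1 (v 2) (st [::] l).
have f1 i : i < b + d -> s1 i = s i.
  by move=> Hi; rewrite /s1 !updateE !v_ge.
have f2 i : i < b + d -> s2 i = s i.
  by move=> Hi; rewrite /s2 updateE v_ge ?f1.
have [||||t' [s5 [e5 l5 r5 f5]]] := loop l [::] s2.
- by [].
- exact: holds_env_eq Hs f2.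
- by rewrite /s2 /s1 !updateE vE /= eqxx.
- by rewrite /s2 update_same.
exists (t' + eval_time e + eval_time init + 7).
exists (update s5 (v 0) (st (rev l) [::])); split; last first.
- by move=> i Hi; rewrite updateE v_ge // f5 ?f2.
- by rewrite /v addn0 updateE eqxx.
- by lia.
apply: exec_time.
  apply: (@ExecThen _ _ _ s1).
    rewrite (_ : s1 = update s (v 0) (eval s (shift b d e))).
      exact: ExecAssign.
    by rewrite eval_shift // El.
  apply: (@ExecThen _ _ _ s2).
    rewrite (_ : s2 = update s1 (v 2) (eval s1 (shift b d init))).
      exact: ExecAssign.
    by rewrite eval_shift ?Ei //; exact: holds_env_eq Hs f1.
  apply: ExecThen e5 _.
  rewrite (_ : update s5 _ _ = update s5 (v 0) (eval s5 (Var (v 2)))).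
    exact: ExecAssign.
  by rewrite /= r5.
by rewrite /= !eval_time_shift; lia.
Qed.

Lemma runs_ret_eq e env x c : evals env e = x -> eval_time e < c ->
  runs (Ret e) env x c.
Proof. by move=> <- le; apply: runs_weaken (runs_ret _ _) le. Qed.

Lemma runs_call_le p args env vals x c c' :
  runs p vals x c -> map (evals env) args = vals ->
  c + sumn (map (fun e => (eval_time e).+2) args) + 3 <= c' ->
  runs (Call p args) env x c'.
Proof. by move=> H E; apply: runs_weaken; apply: runs_call; rewrite E. Qed.

(** Keeps all costs in the shape C * X^k, so that nesting a loop only increments the exponent; 23 is
    the sum of the overheads 13 per round and 10 overall. *)
Lemma runs_loop_pow X k C (T : Type) (enc : T -> tree) (l : seq T)
    (st : seq T -> seq T -> tree) e init p env :
  0 < X -> size l <= X ->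
  evals env e = encode_seq enc l -> evals env init = st [::] l ->
  (forall q x r, l = catrev q (x :: r) ->
     runs p (env ++ [:: encode_seq enc r; enc x; st q (x :: r)])
       (st (x :: q) r) (C * X ^ k)) ->
  runs (Loop e init p) env (st (rev l) [::])
    ((C + eval_time e + eval_time init + 23) * X ^ k.+1).
Proof.
move=> X0 lX El Ei Hp; apply: runs_weaken (runs_loop El Ei Hp) _.
have Y0 : 0 < X ^ k by rewrite expn_gt0 X0.
rewrite expnS; move: (X ^ k) Y0 => Y Y0.
have -> : (C + eval_time e + eval_time init + 23) * (X * Y) =
  (X * (C * Y) + X * Y * 13) + (eval_time e + eval_time init + 10) * (X * Y).
  by rewrite mulnCA; lia.
have XY : X <= X * Y by rewrite leq_pmulr.
have -> : size l * (C * Y + 13) + eval_time e + eval_time init + 10 =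
  size l * (C * Y + 13) + (eval_time e + eval_time init + 10) by lia.
apply: leq_add; last by rewrite leq_pmulr // (leq_trans X0).
apply: leq_trans (_ : X * (C * Y + 13) <= _); first by rewrite leq_mul2r lX orbT.
by rewrite mulnDr leq_add2l leq_mul2r XY orbT.
Qed.

Lemma runs_pow X k k' C C' p env x : 0 < X -> k <= k' -> C <= C' ->
  runs p env x (C * X ^ k) -> runs p env x (C' * X ^ k').
Proof.
move=> X0 kk CC H; apply: runs_weaken H _; apply: leq_mul => //.
exact: leq_pexp2l.
Qed.

Lemma encode_seq_map T U (enc : U -> tree) (f : T -> U) s :
  encode_seq enc (map f s) = encode_seq (fun x => enc (f x)) s.
Proof. by rewrite /encode_seq foldr_map. Qed.

(** * The program *)

Definition true_expr := Pair Defs.Empty Defs.Empty.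

Definition rev_prog : prog :=
  Loop (Var 0) Defs.Empty (Ret (Pair (Var 2) (Var 3))).

Lemma runs_rev X T (enc : T -> tree) l : 0 < X -> size l <= X ->
  runs rev_prog [:: encode_seq enc l] (encode_seq enc (rev l)) (30 * X ^ 1).
Proof.
move=> X0 lX.
apply: runs_pow (runs_loop_pow (k := 0) (C := 5) (enc := enc)
  (st := fun q r => encode_seq enc q) X0 lX _ _ _) => //.
by move=> q x r _; apply: runs_ret_eq.
Qed.

Definition encode_row := encode_seq encode_bool.
Definition encode_mx := encode_seq encode_row.

(** A loop walks through one list only, so the second list is consumed inside the accumulator,
    paired with the output. The output piles up in reverse, hence the final reversal. *)
Definition zip_cons : prog :=
  Let (Loop (Var 0) (Pair (Var 1) Defs.Empty)
         (Ret (Pair (Tl (Hd (Var 4)))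
            (Pair (Pair (Var 3) (Hd (Hd (Var 4)))) (Tl (Var 4))))))
      (Call rev_prog [:: Tl (Var 2)]).

Lemma runs_zip_cons X T (b : seq T) f g : 0 < X -> size b <= X ->
  runs zip_cons [:: encode_row (map f b); encode_mx (map g b)]
    (encode_mx [seq f y :: g y | y <- b]) (100 * X ^ 1).
Proof.
move=> X0 bX.
have L1 := @runs_loop_pow X 0 20 _ (fun y => encode_bool (f y)) b
  (fun q r => Node (encode_mx (map g r))
     (encode_mx [seq f y :: g y | y <- q])) (Var 0) (Pair (Var 1) Defs.Empty)
  (Ret (Pair (Tl (Hd (Var 4)))
     (Pair (Pair (Var 3) (Hd (Hd (Var 4)))) (Tl (Var 4)))))
  [:: encode_row (map f b); encode_mx (map g b)] X0 bX.
have {}L1 := L1 (encode_seq_map _ _ _) erefl.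
apply: runs_weaken (runs_let (L1 _) (runs_call (x := encode_mx _) (c :=
  30 * X ^ 1) _)) _.
- by move=> q x r _; apply: runs_ret_eq.
- rewrite /= /evals /= map_rev -{2}[map _ b]revK.
  by apply: runs_rev; rewrite ?size_rev ?size_map.
- by rewrite /= !expn1; lia.
Qed.

(* The columns of the transpose come out in reverse order. *)
Definition transpose : prog :=
  Let (Loop (Var 0) Defs.Empty (Ret (Pair Defs.Empty (Var 3))))
      (Loop (Var 0) (Var 1) (Call zip_cons [:: Var 3; Var 4])).

Definition mx_of T U (f : T -> U -> bool) a b : seq (seq bool) :=
  [seq [seq f x y | y <- b] | x <- a].

Lemma runs_transpose X T U (f : T -> U -> bool) a b : 0 < X ->
  size a <= X -> size b = size a ->
  runs transpose [:: encode_mx (mx_of f a b)]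
    (encode_mx (mx_of (fun y x => f x y) b (rev a))) (200 * X ^ 2).
Proof.
move=> X0 aX ba.
have El : evals [:: encode_mx (mx_of f a b)] (Var 0) =
    encode_seq (fun x => encode_row [seq f x y | y <- b]) a.
  exact: encode_seq_map.
have L1 := @runs_loop_pow X 0 4 _ _ a
  (fun q r => encode_mx (nseq (size q) [::])) (Var 0) Defs.Empty
  (Ret (Pair Defs.Empty (Var 3))) _ X0 aX El erefl.
have L2 := @runs_loop_pow X 1 120 _ _ a
  (fun q r => encode_mx (mx_of (fun y x => f x y) b q)) (Var 0) (Var 1)
  (Call zip_cons [:: Var 3; Var 4])
  [:: encode_mx (mx_of f a b); encode_mx (nseq (size (rev a)) [::])] X0 aX El.
apply: runs_weaken (runs_let (L1 _) (L2 _ _)) _.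
- by move=> q x r _; apply: runs_ret_eq.
- by rewrite size_rev -ba /= /evals /= /mx_of; elim: b {El L1 L2 ba} => //= y b ->.
- move=> q x r _.
  have bX : size b <= X by rewrite ba.
  apply: (runs_call_le (runs_zip_cons (f x) (fun y =>
    [seq f z y | z <- q]) X0 bX)) => //.
  by rewrite /= expn1; lia.
- have : X <= X ^ 2 by rewrite -{1}[X]expn1 leq_pexp2l.
  by rewrite /= expn1; lia.
Qed.

Lemma runs_cond_le e (b : bool) p q env x c c' :
  is_node (evals env e) = b ->
  (if b then runs p env x c else runs q env x c) ->
  eval_time e + c < c' -> runs (Cond e p q) env x c'.
Proof. by move=> <- H le; apply: runs_weaken (runs_cond H) le. Qed.

Lemma is_node_bool b : is_node (encode_bool b) = b.
Proof. by case: b. Qed.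

Definition sub_row : prog :=
  let keep flag := Ret (Pair (Tl (Hd (Var 4))) flag) in
  Let (Loop (Var 0) (Pair (Var 1) true_expr)
        (Cond (Var 3)
           (Cond (Hd (Hd (Var 4))) (keep (Tl (Var 4))) (keep Defs.Empty))
           (keep (Tl (Var 4)))))
      (Ret (Tl (Var 2))).

Lemma runs_sub_row X T (b : seq T) f g : 0 < X -> size b <= X ->
  runs sub_row [:: encode_row (map f b); encode_row (map g b)]
    (encode_bool (all (fun y => f y ==> g y) b)) (150 * X ^ 1).
Proof.
move=> X0 bX.
have El : evals [:: encode_row (map f b); encode_row (map g b)] (Var 0) =
    encode_seq (fun y => encode_bool (f y)) b by exact: encode_seq_map.
rewrite -all_rev /sub_row /=.
apply: runs_weaken.
  apply: runs_let.
    apply: (runs_loop_pow (k := 0) (C := 30) (st := fun q r =>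
      Node (encode_row (map g r))
       (encode_bool (all (fun y => f y ==> g y) q))) X0 bX El) => [//|q x r _].
    apply: (runs_cond_le (b := f x) (c := 20)) => //; first exact: is_node_bool.
    case fx: (f x); last by apply: runs_ret_eq => //=; rewrite fx.
    apply: (runs_cond_le (b := g x) (c := 10)) => //; first exact: is_node_bool.
    by case gx: (g x); apply: runs_ret_eq => //=; rewrite fx gx.
  by apply: runs_ret_eq.
by rewrite /= expn1; lia.
Qed.

(** This is [encode_int] of 0 or 1: bit vectors are already encoded as the integral vectors to be
    output. The truth value is read off the right subtree. *)
Definition encode_bit (b : bool) : tree :=
  Node Leaf (if b then Node (Node Leaf Leaf) Leaf else Leaf).
Definition bit_expr (b : bool) : expr :=
  Pair Defs.Empty (if b then Pair true_expr Defs.Empty else Defs.Empty).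
Definition encode_bits := encode_seq encode_bit.
Definition encode_bitss := encode_seq encode_bits.

Lemma is_node_bit b : is_node (right_subtree (encode_bit b)) = b.
Proof. by case: b. Qed.

Definition choices_expr (s : seq bool) : expr :=
  foldr (fun b e => Pair (bit_expr b) e) Defs.Empty s.

Definition choices_at : prog :=
  Cond (Var 2) (Ret (choices_expr [:: false]))
    (Let (Call sub_row [:: Var 1; Var 0])
      (Cond (Var 3)
        (Let (Call sub_row [:: Var 0; Var 1])
           (Cond (Var 4) (Ret (choices_expr [:: false; true]))
                         (Ret (choices_expr [:: true]))))
        (Ret (choices_expr [:: false])))).

(* Row w of the matrix of f is the up-set of w for f = lt, its down-set for the
   converse order. The sets S with (x \in S) \in choices f a w x for all x are the
   unions of G_i and a subset of L_i (i = r_w + 1) in the first case, of R_i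
   (i = l_w) in the second. *)
Definition choices T (f : rel T) (a : seq T) (w x : T) : seq bool :=
  if f w x then [:: false]
  else if all (fun y => f x y ==> f w y) a then
    if all (fun y => f w y ==> f x y) a then [:: false; true] else [:: true]
  else [:: false].

Lemma runs_choices_at X T (f : rel T) a w x : 0 < X -> size a <= X ->
  runs choices_at
    [:: encode_row (map (f w) a); encode_row (map (f x) a); encode_bool (f w x)]
    (encode_bits (choices f a w x)) (500 * X ^ 1).
Proof.
move=> X0 aX; rewrite /choices expn1.
apply: (runs_cond_le (b := f w x) (c := 450 * X)) => //=; last by lia.
  exact: is_node_bool.
case: (f w x); first by apply: runs_ret_eq => //=; lia.
apply: runs_weaken.
  apply: runs_let.
    apply: (runs_call_le (runs_sub_row (f x) (f w) X0 aX)) => //.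
  pose c := 200 * X.
  apply: (runs_cond_le (c := c)) (leqnn _).
    exact: is_node_bool.
  case: (all (fun y => f x y ==> f w y) a); last by apply: runs_ret_eq => //=;
    rewrite /c; lia.
  apply: runs_weaken.
    apply: runs_let.
      by apply: (runs_call_le (runs_sub_row (f w) (f x) X0 aX)).
    apply: (runs_cond_le (c := 20)) (leqnn _).
      exact: is_node_bool.
    by case: (all _ a); apply: runs_ret_eq.
  by rewrite /= expn1 /c; lia.
by rewrite /= expn1; lia.
Qed.

Definition extend : prog :=
  Loop (Var 0) Defs.Empty
    (Loop (Var 1) (Var 4) (Ret (Pair (Pair (Var 3) (Var 6)) (Var 7)))).

Lemma runs_extend X s vs : 0 < X -> size s <= X -> size vs <= X ->
  runs extend [:: encode_bits s; encode_bitss vs]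
    (encode_bitss [seq b :: v | b <- rev s, v <- rev vs]) (100 * X ^ 2).
Proof.
move=> X0 sX vX.
apply: (@runs_pow _ 2 _ 65) => //.
apply: (runs_loop_pow (k := 1) (C := 40) (l := s) (enc := encode_bit)
  (st := fun q _ => encode_bitss [seq b :: v | b <- q, v <- rev vs])) => //.
move=> q b r _.
apply: (@runs_pow _ 1 _ 35) => //.
apply: (runs_loop_pow (k := 0) (C := 10) (l := vs) (enc := encode_bits)
  (st := fun q' _ => encode_bitss ([seq b :: v | v <- q'] ++
     [seq b :: v | b <- q, v <- rev vs]))) => //.
by move=> q' v r' _; apply: runs_ret_eq.
Qed.

Fixpoint fillings T (f : rel T) (a : seq T) (w : T) (p : seq T) :
    seq (seq bool) :=
  if p is x :: p' then
    [seq b :: v | b <- rev (choices f a w x), v <- rev (fillings f a w p')]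
  else [:: [::]].

Definition fillings_prog : prog :=
  Let (Loop (Var 0) (Pair (Var 1) (Pair Defs.Empty Defs.Empty))
        (Let (Call choices_at [:: Var 1; Var 3; Hd (Hd (Var 4))])
        (Let (Call extend [:: Var 5; Tl (Var 4)])
          (Ret (Pair (Tl (Hd (Var 4))) (Var 6))))))
      (Ret (Tl (Var 2))).

Lemma size_choices T (f : rel T) a w x : 0 < size (choices f a w x) <= 2.
Proof. by rewrite /choices; do 3?case: ifP. Qed.

(** Holds because [choices] is never empty; it bounds the intermediate lists of [fillings_prog] by
    the final one. *)
Lemma size_fillings_cat T (f : rel T) a w p q :
  size (fillings f a w p) <= size (fillings f a w (q ++ p)).
Proof.
elim: q => //= x q; set A := fillings _ _ _ _ => H.
rewrite size_allpairs !size_rev (leq_trans H) // leq_pmull //.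
by case/andP: (size_choices f a w x).
Qed.

Lemma runs_fillings X T (f : rel T) a w : 1 < X -> size a <= X ->
  size (fillings f a w (rev a)) <= X ->
  runs fillings_prog [:: encode_mx (mx_of f a a); encode_row (map (f w) a)]
    (encode_bitss (fillings f a w (rev a))) (800 * X ^ 3).
Proof.
move=> X1 aX fX; have X0 : 0 < X by exact: ltnW.
have El : evals [:: encode_mx (mx_of f a a); encode_row (map (f w) a)] (Var 0) =
    encode_seq (fun x => encode_row [seq f x y | y <- a]) a.
  exact: encode_seq_map.
apply: runs_weaken.
  apply: runs_let.
    apply: (runs_loop_pow (k := 2) (C := 700) (st := fun q r =>
      Node (encode_row (map (f w) r)) (encode_bitss (fillings f a w q)))
      X0 aX El) => [//|q x r aE].
    have qX : size (fillings f a w q) <= X.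
      apply: leq_trans fX; rewrite aE -[catrev _ _]revK -/(rev q).
      by rewrite catrevE rev_cat !revK size_fillings_cat.
    apply: runs_weaken.
      apply: runs_let.
        by apply: (runs_call_le (runs_choices_at f w x X0 aX)).
      apply: runs_let.
        have sX : size (choices f a w x) <= X.
          by apply: leq_trans _ X1; case/andP: (size_choices f a w x).
        by apply: (runs_call_le (runs_extend X0 sX qX)).
      by apply: runs_ret_eq.
    have : X ^ 1 <= X ^ 2 by rewrite leq_pexp2l.
    have : 0 < X ^ 1 by rewrite expn_gt0 X0.
    by rewrite /=; lia.
  by apply: runs_ret_eq.
have : 0 < X ^ 3 by rewrite expn_gt0 X0.
by rewrite /=; lia.
Qed.

(** One test serves three purposes: disjoint union, equality (the second summand being zero) and
    emptiness (S = S + S holds only for the empty set). *)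
Definition sum_test : prog :=
  let next flag :=
    Ret (Pair (Pair (Tl (Hd (Hd (Var 5)))) (Tl (Tl (Hd (Var 5))))) flag) in
  let test b := if b then Cond (Tl (Var 4)) (next (Tl (Var 5))) (next Defs.Empty)
    else Cond (Tl (Var 4)) (next Defs.Empty) (next (Tl (Var 5))) in
  Let (Loop (Var 2) (Pair (Pair (Var 0) (Var 1)) true_expr)
        (Cond (Tl (Hd (Hd (Hd (Var 5)))))
           (Cond (Tl (Hd (Tl (Hd (Var 5))))) (next Defs.Empty) (test true))
           (Cond (Tl (Hd (Tl (Hd (Var 5))))) (test true) (test false))))
      (Ret (Tl (Var 3))).

Definition is_sum (a b c : bool) : bool := ~~ (a && b) && (c == a || b).

(* The second summand is given by an abstract encoding [eg], so that the empty
   list may stand for the zero vector. *)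
Lemma runs_sum_test X T (e : seq T) (f g h : T -> bool) (eg : seq T -> tree) :
  0 < X -> size e <= X ->
  (forall x r, is_node (right_subtree (left_subtree (eg (x :: r)))) = g x) ->
  (forall x r, right_subtree (eg (x :: r)) = eg r) ->
  runs sum_test [:: encode_bits (map f e); eg e; encode_bits (map h e)]
    (encode_bool (all (fun x => is_sum (f x) (g x) (h x)) e)) (200 * X ^ 1).
Proof.
move=> X0 eX eg1 eg2; rewrite -all_rev /sum_test.
have El : evals [:: encode_bits (map f e); eg e; encode_bits (map h e)] (Var 2)
    = encode_seq (fun y => encode_bit (h y)) e by exact: encode_seq_map.
apply: runs_weaken.
  apply: runs_let.
    apply: (runs_loop_pow (k := 0) (C := 70) (st := fun q r =>
      Node (Node (encode_bits (map f r)) (eg r))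
       (encode_bool (all (fun x => is_sum (f x) (g x) (h x)) q))) X0 eX El)
       => [//|q x r _].
    apply: (runs_cond_le (b := f x) (c := 60)) => //; first exact: is_node_bit.
    have Eg c : evals ([:: encode_bits (map f e); eg e; encode_bits (map h e)] ++
       [:: encode_seq (fun y => encode_bit (h y)) r; encode_bit (h x);
        Node (Node (encode_bits (map f (x :: r))) (eg (x :: r))) c])
        (Tl (Hd (Tl (Hd (Var 5))))) =
        right_subtree (left_subtree (eg (x :: r))) by [].
    case fx: (f x).
      apply: (runs_cond_le (b := g x) (c := 40)) => //; first by rewrite Eg eg1.
      case gx: (g x).
        by apply: runs_ret_eq => //=; rewrite /evals /= eg2 /is_sum fx gx.
      apply: (runs_cond_le (b := h x) (c := 20)) => //; first exact: is_node_bit.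
      by case hx: (h x); apply: runs_ret_eq => //=;
        rewrite /evals /= eg2 /is_sum fx gx hx.
    apply: (runs_cond_le (b := g x) (c := 40)) => //; first by rewrite Eg eg1.
    case gx: (g x);
    apply: (runs_cond_le (b := h x) (c := 20)) => //; try exact: is_node_bit;
    by case hx: (h x); apply: runs_ret_eq => //=;
        rewrite /evals /= eg2 /is_sum fx gx hx.
  by apply: runs_ret_eq.
by rewrite /= expn1; lia.
Qed.

(** * Lists of finite sets as lists of bit vectors *)

Section SetLists.
Variables (T : finType) (X : nat) (e : seq T).
Hypotheses (X_gt1 : 1 < X) (e_size : size e <= X) (mem_e : forall x, x \in e).
Implicit Types (S A B : {set T}) (L : seq {set T}).

Let X_gt0 : 0 < X := ltnW X_gt1.

Definition set_bits S : seq bool := [seq x \in S | x <- e].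
Definition encode_set S : tree := encode_bits (set_bits S).
Definition encode_sets : seq {set T} -> tree := encode_seq encode_set.

Definition set_sum A B S : bool := [disjoint A & B] && (S == A :|: B).

Lemma all_is_sum A B S :
  all (fun x => is_sum (x \in A) (x \in B) (x \in S)) e = set_sum A B S.
Proof.
apply/allP/andP => [H | [dAB /eqP-> x _]].
  split; last by apply/eqP/setP=> x; have /andP[_ /eqP] := H x (mem_e x);
    rewrite inE.
  by rewrite disjoint_subset; apply/fintype.subsetP => x xA; have /andP[] :=
    H x (mem_e x); rewrite xA inE.
by rewrite /is_sum inE eqxx andbT; apply/negP=> /andP[xA];
  rewrite (disjointFr dAB xA).
Qed.

Lemma runs_set_sum A B S :
  runs sum_test [:: encode_set A; encode_set B; encode_set S]
    (encode_bool (set_sum A B S)) (200 * X ^ 1).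
Proof.
rewrite -all_is_sum; apply: (@runs_sum_test X T e _ _ _
  (fun r => encode_bits [seq x \in B | x <- r])) => // x r; exact: is_node_bit.
Qed.

Lemma runs_set_eq A S :
  runs sum_test [:: encode_set A; Leaf; encode_set S]
    (encode_bool (A == S)) (200 * X ^ 1).
Proof.
have -> : (A == S) = set_sum A finset.set0 S.
  by rewrite /set_sum finset.setU0 -setI_eq0 finset.setI0 eqxx eq_sym.
rewrite -all_is_sum; apply: (@runs_sum_test X T e _ _ _ (fun=> Leaf)) => // x r.
by rewrite inE.
Qed.

Definition mem_prog : prog :=
  Loop (Var 1) Defs.Empty
    (Cond (Var 4) (Ret (Var 4)) (Call sum_test [:: Var 3; Defs.Empty; Var 0])).

Lemma runs_mem S L : size L <= X ->
  runs mem_prog [:: encode_set S; encode_sets L] (encode_bool (S \in L))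
    (300 * X ^ 2).
Proof.
move=> LX; rewrite -mem_rev -has_pred1 /mem_prog.
apply: runs_pow X_gt0 (leqnn 2) _ (runs_loop_pow (k := 1) (C := 240)
  (enc := encode_set)
  (st := fun q _ => encode_bool (has (pred1 S) q)) X_gt0 LX _ _ _) => //.
move=> q A r _; rewrite expn1.
apply: (runs_cond_le (b := has (pred1 S) q) (c := 220 * X)).
- exact: is_node_bool.
- case E: (has _ q).
    by apply: runs_ret_eq; [rewrite /evals /= E orbT | rewrite /=; lia].
  rewrite /= E orbF; apply: (runs_call_le (runs_set_eq A S)) => //.
  by rewrite /= expn1; lia.
by rewrite /=; lia.
Qed.

Definition collect_prog : prog :=
  Loop (Var 0) (Var 1)
    (Let (Call sum_test [:: Var 3; Var 3; Var 3])
      (Cond (Var 5) (Ret (Var 4))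
        (Let (Call mem_prog [:: Var 3; Var 4])
           (Cond (Var 6) (Ret (Var 4)) (Ret (Pair (Var 3) (Var 4))))))).

Fixpoint collect (Q L : seq {set T}) : seq {set T} :=
  if Q is A :: Q' then
    let L' := collect Q' L in
    if (A == finset.set0) || (A \in L') then L' else A :: L'
  else L.

Lemma set_sum_diag S : set_sum S S S = (S == finset.set0).
Proof. by rewrite /set_sum finset.setUid eqxx andbT -setI_eq0 finset.setIid. Qed.

Lemma mem_collect Q L S :
  (S \in collect Q L) = (S \in L) || (S != finset.set0) && (S \in Q).
Proof.
elim: Q => [|A Q IH] /=; first by rewrite andbF orbF.
have [-> | A0 /=] := eqVneq A finset.set0.
  by rewrite IH inE; case: (S == finset.set0); rewrite ?andbF.
case: ifP => [AL|_].
  have [->|SA] := eqVneq S A; first by rewrite AL A0 inE eqxx orbT.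
  by rewrite IH inE (negbTE SA).
by rewrite inE IH inE; have [->|//] := eqVneq S A; rewrite A0 ?orbT.
Qed.

Lemma collect_uniq Q L : uniq L -> uniq (collect Q L).
Proof.
move=> uL; elim: Q => //= A Q IH; case: ifP => // /negbT.
by rewrite negb_or /= => /andP[_ ->].
Qed.

(** Different elements w can produce the same sets; dropping repetitions keeps the growing list
    duplicate-free inside E, and this bounds its length. *)
Lemma size_collect (E : {set {set T}}) Q L : uniq L -> {subset L <= E} ->
  (forall S, S != finset.set0 -> S \in Q -> S \in E) -> size (collect Q L) <= #|E|.
Proof.
move=> uL LE QE; rewrite cardE; apply: uniq_leq_size (collect_uniq _ uL) _.
by move=> S; rewrite mem_collect mem_enum => /orP[/LE // | /andP[]]; exact: QE.
Qed.

Lemma runs_collect (E : {set {set T}}) Q L : uniq L -> {subset L <= E} ->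
  (forall S, S != finset.set0 -> S \in Q -> S \in E) -> #|E| <= X ->
  size Q <= X ->
  runs collect_prog [:: encode_sets Q; encode_sets L]
    (encode_sets (collect (rev Q) L)) (650 * X ^ 3).
Proof.
move=> uL LE QE EX QX.
apply: runs_pow X_gt0 (leqnn 3) _ (runs_loop_pow (k := 2) (C := 600)
  (enc := encode_set)
  (st := fun q _ => encode_sets (collect q L)) X_gt0 QX _ _ _) => //.
move=> q S r QQ.
have qX : size (collect q L) <= X.
  apply: leq_trans EX; apply: size_collect => // A A0 Aq; apply: QE => //.
  by rewrite QQ catrevE mem_cat mem_rev Aq.
have X12 : X ^ 1 <= X ^ 2 by rewrite leq_pexp2l.
have X2 : 0 < X ^ 2 by rewrite expn_gt0 X_gt0.
apply: runs_weaken.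
  apply: runs_let; first by apply: (runs_call_le (runs_set_sum S S S)).
  rewrite set_sum_diag.
  apply: (runs_cond_le (b := S == finset.set0) (c := 340 * X ^ 2)) (leqnn _).
    exact: is_node_bool.
  case E0 : (S == finset.set0).
    by apply: runs_ret_eq; rewrite /evals /= ?E0 //; lia.
  apply: runs_weaken.
    apply: runs_let; first by apply: (runs_call_le (runs_mem S qX)).
    apply: (runs_cond_le (b := S \in collect q L) (c := 20)) (leqnn _).
      exact: is_node_bool.
    by case E1: (S \in _); apply: runs_ret_eq; rewrite /evals /= ?E0 ?E1.
  by rewrite /=; lia.
by rewrite /=; lia.
Qed.

Definition splits L S : bool :=
  has (fun A => has (fun B => set_sum A B S) L) L.

Definition splits_prog : prog :=
  Loop (Var 1) Defs.Empty
    (Cond (Var 4) (Ret (Var 4))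
      (Loop (Var 1) (Var 4)
        (Cond (Var 7) (Ret (Var 7)) (Call sum_test [:: Var 3; Var 6; Var 0])))).

Lemma runs_splits S L : size L <= X ->
  runs splits_prog [:: encode_set S; encode_sets L] (encode_bool (splits L S))
    (400 * X ^ 3).
Proof.
move=> LX.
have -> : splits L S = has (fun A => has (fun B => set_sum A B S) (rev L)) (rev L).
  by rewrite has_rev; apply: eq_has => A; rewrite has_rev.
apply: runs_pow X_gt0 (leqnn 3) _ (runs_loop_pow (k := 2) (C := 350)
  (enc := encode_set)
  (st := fun q _ => encode_bool
     (has (fun A => has (fun B => set_sum A B S) (rev L)) q)) X_gt0 LX _ _ _) => //.
move=> q A r _; set o := has _ q.
have X2 : 0 < X ^ 2 by rewrite expn_gt0 X_gt0.
apply: (runs_cond_le (b := o) (c := 340 * X ^ 2)).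
- exact: is_node_bool.
- case E: o.
    by apply: runs_ret_eq; [rewrite /evals /= -/o E orbT | rewrite /=; lia].
  rewrite /= -/o E orbF.
  apply: runs_pow X_gt0 (leqnn 2) _ (runs_loop_pow (k := 1) (C := 240)
    (enc := encode_set)
    (st := fun q' _ => encode_bool (has (fun B => set_sum A B S) q'))
    X_gt0 LX _ _ _) => //.
  move=> q' B r' _; rewrite expn1; set o' := has _ q'.
  apply: (runs_cond_le (b := o') (c := 220 * X)).
  + exact: is_node_bool.
  + case E' : o'.
      by apply: runs_ret_eq; [rewrite /evals /= -/o' E' orbT | rewrite /=; lia].
    rewrite /= -/o' E' orbF; apply: (runs_call_le (runs_set_sum A B S)) => //.
    by rewrite /= expn1; lia.
  + by rewrite /=; lia.
- by rewrite /=; lia.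
Qed.

Definition filter_prog : prog :=
  Loop (Var 0) Defs.Empty
    (Let (Call splits_prog [:: Var 2; Var 0])
       (Cond (Var 4) (Ret (Var 3)) (Ret (Pair (Var 2) (Var 3))))).

Lemma runs_filter L : size L <= X ->
  runs filter_prog [:: encode_sets L]
    (encode_sets [seq S <- rev L | ~~ splits L S]) (600 * X ^ 4).
Proof.
move=> LX.
apply: runs_pow X_gt0 (leqnn 4) _ (runs_loop_pow (k := 3) (C := 500)
  (enc := encode_set)
  (st := fun q _ => encode_sets [seq S <- q | ~~ splits L S]) X_gt0 LX _ _ _) => //.
move=> q S r _.
have X3 : 0 < X ^ 3 by rewrite expn_gt0 X_gt0.
apply: runs_weaken.
  apply: runs_let; first by apply: (runs_call_le (runs_splits S LX)).
  apply: (runs_cond_le (b := splits L S) (c := 20)) (leqnn _).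
    exact: is_node_bool.
  by case E: (splits L S); apply: runs_ret_eq; rewrite /evals /= ?E.
by rewrite /=; lia.
Qed.

Hypothesis e_uniq : uniq e.

Definition set_of_bits (v : seq bool) : {set T} :=
  [set x | nth false v (index x e)]%SET.

Lemma set_bitsK v : size v = size e -> set_bits (set_of_bits v) = v.
Proof.
move=> sv; apply: (@eq_from_nth _ false); first by rewrite size_map.
rewrite size_map => i ie.
have x0 : T by case: e ie.
by rewrite (nth_map x0) // inE index_uniq.
Qed.

Lemma size_fillings U (f : rel U) a w p v :
  v \in fillings f a w p -> size v = size p.
Proof.
elim: p v => [|x p IH] v /=; first by rewrite inE => /eqP->.
by case/allpairsP=> -[b u] /= [_ ]; rewrite mem_rev => /IH {}IH ->; rewrite /= IH.
Qed.

Arguments size_fillings {U f a w p v}.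

Lemma uniq_fillings U (f : rel U) a w p : uniq (fillings f a w p).
Proof.
elim: p => //= x p IH; rewrite allpairs_uniq ?rev_uniq //.
- by rewrite /choices; do 3?case: ifP.
- by move=> [b u] [b' u'] _ _ /= [-> ->].
Qed.

Lemma mem_fillings (f : rel T) a w p S :
  ([seq x \in S | x <- p] \in fillings f a w p) =
  all (fun x => (x \in S) \in choices f a w x) p.
Proof.
elim: p => //= x p IH; rewrite -IH; apply/allpairsP/andP => /=.
  by case=> -[b u] /= []; rewrite !mem_rev => ? ? [-> ->].
by case=> H1 H2; exists (x \in S, [seq y \in S | y <- p]); rewrite !mem_rev.
Qed.

Definition filling_sets (f : rel T) (w : T) : seq {set T} :=
  map set_of_bits (fillings f (rev e) w e).

Lemma encode_filling_sets f w :
  encode_sets (filling_sets f w) = encode_bitss (fillings f (rev e) w e).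
Proof.
rewrite /encode_sets encode_seq_map /encode_bitss /encode_set.
have : all (fun v => size v == size e) (fillings f (rev e) w e).
  by apply/allP=> v /size_fillings->.
by elim: (fillings _ _ _ _) => //= v q IH /andP[/eqP sv /IH ->]; rewrite set_bitsK.
Qed.

Lemma mem_filling_sets f w S :
  (S \in filling_sets f w) = [forall x, (x \in S) \in choices f (rev e) w x].
Proof.
have bitsK : set_of_bits (set_bits S) = S.
  apply/setP=> x; rewrite inE (nth_map x) ?index_mem ?mem_e //.
  by rewrite nth_index ?mem_e.
transitivity (set_bits S \in fillings f (rev e) w e).
  apply/mapP/idP => [[v v_in ->]|?]; last by exists (set_bits S).
  by rewrite set_bitsK // (size_fillings v_in).
rewrite mem_fillings; apply/allP/forallP => H x; last by move=> _; exact: H.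
exact: H.
Qed.

Lemma uniq_filling_sets f w : uniq (filling_sets f w).
Proof.
rewrite map_inj_in_uniq ?uniq_fillings // => u v uf vf E.
by rewrite -[u]set_bitsK ?E ?set_bitsK ?(size_fillings uf) ?(size_fillings vf).
Qed.

Definition gen_prog : prog :=
  Loop (Var 0) (Var 1)
    (Let (Call fillings_prog [:: Var 0; Var 3])
      (Call collect_prog [:: Var 5; Var 4])).

Definition gen f (q : seq T) (L : seq {set T}) : seq {set T} :=
  foldr (fun w L' => collect (rev (filling_sets f w)) L') L q.

Lemma gen_uniq f q L : uniq L -> uniq (gen f q L).
Proof. by move=> uL; elim: q => //= w q IH; exact: collect_uniq. Qed.

Lemma mem_gen f q L S : (S \in gen f q L) =
  (S \in L) || (S != finset.set0) && has (fun w => S \in filling_sets f w) q.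
Proof.
elim: q => [|w q IH] /=; first by rewrite andbF orbF.
rewrite mem_collect IH mem_rev andb_orr.
by rewrite -orbA; congr orb; rewrite orbC.
Qed.

Lemma runs_gen (E : {set {set T}}) f L : uniq L -> {subset L <= E} ->
  (forall w S, S != finset.set0 -> S \in filling_sets f w -> S \in E) ->
  #|E| < X ->
  runs gen_prog [:: encode_mx (mx_of f (rev e) (rev e)); encode_sets L]
    (encode_sets (gen f e L)) (1600 * X ^ 4).
Proof.
move=> uL LE fE EX; set a := rev e.
have aX : size a <= X by rewrite size_rev.
have El : evals [:: encode_mx (mx_of f a a); encode_sets L] (Var 0) =
    encode_seq (fun x => encode_row [seq f x y | y <- a]) a.
  exact: encode_seq_map.
rewrite -[e in gen f e L]revK -/a.
apply: runs_pow X_gt0 (leqnn 4) _ (runs_loop_pow (k := 3) (C := 1500)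
  (st := fun q _ => encode_sets (gen f q L)) X_gt0 aX El _ _) => //.
move=> q w r _.
have X3 : 0 < X ^ 3 by rewrite expn_gt0 X_gt0.
(* The empty set may be a filling although it need not lie in E; the strict bound on #|E| leaves
   room for it. *)
have sX : size (filling_sets f w) <= X.
  apply: leq_trans EX.
  have /leq_trans -> // : size (filling_sets f w) <= #|finset.set0 |: E|.
    rewrite cardE; apply: uniq_leq_size (uniq_filling_sets _ _) _ => S Sf.
    by rewrite mem_enum !inE; case: eqVneq => //= S0; apply: fE Sf.
  by rewrite cardsU1; case: (_ \in _); rewrite ?add1n ?add0n.
have sE : {subset gen f q L <= E}.
  move=> S; rewrite mem_gen => /orP[/LE // | /andP[S0 /hasP[v _]]]; exact: fE.
have sX' : size (fillings f a w (rev a)) <= X by rewrite revK -(size_map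
  set_of_bits).
apply: runs_weaken.
  apply: runs_let.
    by apply: (runs_call_le (runs_fillings X_gt1 aX sX')).
  rewrite revK -encode_filling_sets.
  by apply: (runs_call_le (runs_collect (gen_uniq _ _ uL) sE (fE w) (ltnW EX) sX)).
by rewrite /=; lia.
Qed.

(** Two transpositions give the matrix of f with rows and columns reversed; one transposition and a
    reversal of the rows give that of the converse relation in the same order. Since bit vectors are
    built by prepending, they then come out in the order of e. *)
Definition main_prog : prog :=
  Let (Call transpose [:: Var 0])
 (Let (Call transpose [:: Var 1])
 (Let (Call rev_prog [:: Var 1])
 (Let (Call gen_prog [:: Var 2; Defs.Empty])
 (Let (Call gen_prog [:: Var 3; Var 4])
      (Call filter_prog [:: Var 5]))))).

Definition found (f : rel T) : seq {set T} :=
  gen (fun y x => f x y) e (gen f e [::]).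

Lemma found_uniq f : uniq (found f).
Proof. by do 2!apply: gen_uniq. Qed.

Lemma mem_found f S : (S \in found f) = (S != finset.set0) &&
  [exists w, (S \in filling_sets f w) || (S \in filling_sets (fun y x => f x y) w)].
Proof.
rewrite !mem_gen /= -andb_orr; congr andb; rewrite -has_predU /=.
apply/hasP/existsP => [[w _ H]|[w H]]; first by exists w.
by exists w; rewrite ?mem_e.
Qed.

Lemma runs_main f : #|[set S in found f]%SET| < X ->
  runs main_prog [:: encode_mx (mx_of f e e)]
    (encode_sets [seq S <- rev (found f) | ~~ splits (found f) S]) (4700 * X ^ 4).
Proof.
set E := [set S in found f]%SET => EX.
have X1 : 0 < X ^ 1 by rewrite expn_gt0 X_gt0.
have X24 : X ^ 2 <= X ^ 4 by rewrite leq_pexp2l.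
have X14 : X ^ 1 <= X ^ 4 by rewrite leq_pexp2l.
have fE w S : S != finset.set0 -> S \in filling_sets f w -> S \in E.
  by move=> S0 Sw; rewrite inE mem_found S0; apply/existsP; exists w; rewrite Sw.
have fE' w S : S != finset.set0 -> S \in filling_sets (fun y x => f x y) w ->
  S \in E.
  by move=> S0 Sw; rewrite inE mem_found S0; apply/existsP; exists w;
    rewrite Sw orbT.
have sE : {subset gen f e [::] <= E}.
  by move=> S; rewrite mem_gen /= => /andP[S0 /hasP[w _]]; exact: fE.
have sF : size (found f) <= X.
  rewrite (leq_trans _ (ltnW EX)) // cardE.
  by apply: uniq_leq_size (found_uniq f) _ => S; rewrite mem_enum inE.
have Er : encode_mx (mx_of (fun y x => f x y) (rev e) (rev e)) =
  encode_seq encode_row (rev (mx_of (fun y x =>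
    f x y) e (rev e))) by rewrite /mx_of map_rev.
apply: runs_weaken.
  apply: runs_let.
    by apply: (runs_call_le (runs_transpose f X_gt0 e_size erefl)).
  apply: runs_let.
    by apply: (runs_call_le (runs_transpose (fun y x =>
      f x y) X_gt0 e_size (size_rev _))).
  apply: runs_let.
    by apply: (runs_call_le (runs_rev encode_row
      (l := mx_of (fun y x => f x y) e (rev e)) X_gt0 _)); rewrite ?size_map.
  rewrite -Er.
  apply: runs_let.
    by apply: (runs_call_le (@runs_gen E f [::] _ _ fE EX)).
  apply: runs_let.
    by apply: (runs_call_le (@runs_gen E _ _ (@gen_uniq f e [::] isT) sE fE' EX)).
  by apply: (runs_call_le (runs_filter sF)).
by rewrite /=; lia.
Qed.
End SetLists.

Definition main_cmd : cmd := Then (main_prog 0 1) (Assign 0 (Var 1)).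

Lemma runs_computes x y c : runs main_prog [:: x] y c ->
  exists2 t, computes_in main_cmd x y t & t <= c + 3.
Proof.
case=> /(_ 0 (update (fun=> Leaf) 0 x))[[|] //|t [s' [H1 H2 H3 _]]].
exists (t + 2).+1; last by rewrite -addnS leq_add2r.
eexists; split; first by apply: ExecThen H1 _; exact: ExecAssign.
by rewrite /= update_same.
Qed.
End Combinators.

(** * The canonical representation *)

Section Canonical.
Local Open Scope nat_scope.
Variables (n : nat) (lt : rel 'I_n).

Let downs : {set {set 'I_n}} := [set down_set lt z | z in 'I_n]%SET.

(** Comparing left endpoints shows that the down-sets form a chain. The new left endpoint of x is
    the position of D(x) in this chain, the right endpoint the last position whose down-set omits x;
    thus [lt x y] means that D(y) comes later. As [outer x] contains D(x), the predecessor is not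
    truncated. *)
Lemma canonical_rep_exists (R : realType) : interval_order R lt ->
  exists lr : {ffun 'I_n -> nat} * {ffun 'I_n -> nat}, canonical_rep lt lr.1 lr.2.
Proof.
case=> l [r [lr ltE]].
have irr x : ~~ lt x x by apply/negP=> /ltE; rewrite ltNge lr.
have chain x y : (down_set lt x \subset down_set lt y) ||
  (down_set lt y \subset down_set lt x).
  have sub u v : (l u <= l v)%R -> down_set lt u \subset down_set lt v.
    move=> uv; apply/fintype.subsetP => w; rewrite !inE => /ltE wu.
    by apply/ltE; exact: Order.POrderTheory.lt_le_trans uv.
  by case/orP: (Order.TotalTheory.le_total (l x) (l y)) => /sub->; rewrite ?orbT.
have proper_or x y : ~~ (down_set lt y \subset down_set lt x) ->
    down_set lt x \proper down_set lt y.
  by move=> yx; rewrite properE yx andbT; have := chain x y;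
    rewrite (negbTE yx) orbF.
pose rank (A : {set 'I_n}) := #|[set B in downs | B \proper A]%SET|.
pose outer x := [set B in downs | x \notin B]%SET.
have in_downs x : down_set lt x \in downs by exact: imset_f.
have outer_gt0 x : 0 < #|outer x|.
  by apply/card_gt0P; exists (down_set lt x); rewrite !inE in_downs irr.
have rank_lt A : A \in downs -> rank A < magnitude lt.
  move=> A_in; apply: proper_card; apply/properP; split.
    by apply/fintype.subsetP => B; rewrite inE => /andP[].
  by exists A => //; rewrite inE fintype.properxx andbF.
have rank_mono (A B : {set _}) : A \in downs -> A \proper B -> rank A < rank B.
  move=> A_in AB; apply: proper_card; apply/properP; split.
    apply/fintype.subsetP => C; rewrite !inE => /andP[-> CA].
    exact: proper_trans CA AB.
  by exists A; rewrite !inE ?A_in ?AB // fintype.properxx.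
have rank_inj : {in downs &, injective rank}.
  move=> _ _ /imsetP[x _ ->] /imsetP[y _ ->] E.
  apply/eqP; rewrite finset.eqEsubset; apply/andP; split; apply/contraT =>
    /proper_or.
    by move/(rank_mono _ _ (in_downs y)); rewrite E ltnn.
  by move/(rank_mono _ _ (in_downs x)); rewrite E ltnn.
have rank_surj k : k < magnitude lt -> exists2 A, A \in downs & rank A = k.
  have [|||_ E] := @uniq_min_size _ (map rank (enum downs)) (iota 0 (magnitude lt)).
  - by rewrite map_inj_in_uniq ?enum_uniq // => A B; rewrite !mem_enum;
    exact: rank_inj.
  - move=> j /mapP[A]; rewrite mem_enum => A_in ->.
    by rewrite mem_iota rank_lt.
  - by rewrite size_map size_iota -cardE.
  have := E k; rewrite mem_iota /= add0n => <- /mapP[A]; rewrite mem_enum => ? ->.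
  by exists A.
exists ([ffun x => rank (down_set lt x)], [ffun x => #|outer x|.-1]); split;
  first split.
- move=> x; rewrite !ffunE -ltnS prednK //; apply: proper_card; apply/properP;
  split.
    apply/fintype.subsetP => B; rewrite !inE => /andP[-> /properP[Bx _]] /=.
    by apply/negP => /(fintype.subsetP Bx); rewrite inE (negbTE (irr x)).
  by exists (down_set lt x); rewrite !inE ?in_downs ?irr // fintype.properxx.
- move=> x y; rewrite !ffunE prednK //; split=> [xy | ].
    apply/subset_leq_card/fintype.subsetP => B; rewrite !inE => /andP[B_in xB].
    rewrite B_in /=; case/imsetP: B_in xB => z _ -> xz.
    apply: proper_or; apply/negP => /fintype.subsetP/(_ x).
    by rewrite [x \in down_set lt y]inE xy (negbTE xz) => /(_ isT).
  move=> le; apply: contraT => xy; move: le; rewrite leqNgt => /negP[].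
  apply: proper_card; apply/properP; split.
    apply/fintype.subsetP => B; rewrite !inE => /andP[-> /properP[By _]] /=.
    by apply/negP => /(fintype.subsetP By); rewrite inE (negbTE xy).
  by exists (down_set lt y); rewrite !inE ?in_downs ?xy // fintype.properxx.
move=> k; split=> [[x] | k_lt]; last first.
  have [A /imsetP[x _ ->] <-] := rank_surj k k_lt.
  by exists x; left; rewrite /= ffunE.
case=> <-; rewrite /= ffunE; first exact: rank_lt.
rewrite prednK //; apply/subset_leq_card/fintype.subsetP => B.
by rewrite inE => /andP[].
Qed.

Hypothesis canon : exists lr : {ffun 'I_n -> nat} * {ffun 'I_n -> nat},
  canonical_rep lt lr.1 lr.2.

Lemma canonicalP : canonical_rep lt (cleft lt) (cright lt).
Proof.
exact: (@xgetPex _ ([ffun=> 0], [ffun=> 0])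
  [set lr : {ffun 'I_n -> nat} * {ffun 'I_n -> nat} |
    canonical_rep lt lr.1 lr.2]%classic canon).
Qed.

Lemma cleft_le_cright x : cleft lt x <= cright lt x.
Proof. by case: canonicalP => -[]. Qed.

Lemma canonical_ltE x y : lt x y = (cright lt x < cleft lt y).
Proof. by case: canonicalP => -[_ H _]; apply/idP/idP => /H. Qed.

Lemma cright_lt x : cright lt x < magnitude lt.
Proof. by case: canonicalP => _ H; apply/H; exists x; right. Qed.

Lemma cleft_lt x : cleft lt x < magnitude lt.
Proof. exact: leq_ltn_trans (cleft_le_cright x) (cright_lt x). Qed.

Let below k : {set 'I_n} := [set x | cright lt x < k]%SET.
Let lefts := undup (map (cleft lt) (enum 'I_n)).

Let downs_sub : {subset enum downs <= map below lefts}.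
Proof.
move=> A; rewrite mem_enum => /imsetP[z _ ->].
apply/mapP; exists (cleft lt z); first by rewrite mem_undup map_f ?mem_enum.
by apply/setP=> x; rewrite !inE canonical_ltE.
Qed.

Let lefts_iota : {subset lefts <= iota 0 (magnitude lt)}.
Proof.
by move=> k; rewrite mem_undup => /mapP[x _ ->]; rewrite mem_iota cleft_lt.
Qed.

Let size_lefts : magnitude lt <= size lefts.
Proof.
rewrite -(size_map below) /magnitude cardE.
exact: uniq_leq_size (enum_uniq _) downs_sub.
Qed.

Let lefts_eq : lefts =i iota 0 (magnitude lt).
Proof.
by case: (uniq_min_size (undup_uniq _) lefts_iota) => //; rewrite size_iota.
Qed.

(** The down-set of z depends only on its left endpoint, so there are at least m left endpoints; as
    all are below m, no value is missed. *)
Lemma ex_cleft k : k < magnitude lt -> exists x, cleft lt x = k.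
Proof.
have := lefts_eq k; rewrite mem_iota /= add0n => <-.
by rewrite mem_undup => /mapP[x _ ->]; exists x.
Qed.

(* Otherwise two of the [magnitude lt] down-sets would coincide. *)
Lemma ex_cright k : k < magnitude lt -> exists x, cright lt x = k.
Proof.
move=> km; have [k1m|mk] := ltnP k.+1 (magnitude lt); last first.
  have [x xk] := ex_cleft km; exists x; apply/eqP; rewrite eqn_leq.
  by rewrite -{2}xk cleft_le_cright andbT -ltnS (leq_trans (cright_lt x)).
have u : uniq (map below (iota 0 (magnitude lt))).
  apply: leq_size_uniq (enum_uniq downs) _ _.
    by move=> A /downs_sub /mapP[i]; rewrite lefts_eq => ? ->; exact: map_f.
  by rewrite size_map size_iota -cardE.
have: below k != below k.+1.
  apply/eqP => E; have := nth_uniq (below 0) _ _ u.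
  move/(_ k k.+1); rewrite size_map size_iota => /(_ km k1m).
  rewrite !(nth_map 0) ?size_iota // !nth_iota // !add0n E eqxx.
  by rewrite ltn_eqF.
move=> ne; have /existsP[x /eqP ?] : [exists x, cright lt x == k]; last by exists x.
apply: contraR ne => /existsPn H; apply/eqP/setP => x; rewrite !inE.
by rewrite ltnS [RHS]leq_eqVlt (negbTE (H x)).
Qed.
End Canonical.

(** * Fundamental extenders *)

Section Extenders.
Local Open Scope nat_scope.
Variables (n : nat) (lt : rel 'I_n).
Hypothesis canon : exists lr : {ffun 'I_n -> nat} * {ffun 'I_n -> nat},
  canonical_rep lt lr.1 lr.2.
Notation l := (cleft lt).
Notation r := (cright lt).
Notation m := (magnitude lt).
Implicit Types (S A B : {set 'I_n}) (x y z : 'I_n) (i j k t : nat).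

Let lr x : l x <= r x. Proof. exact: cleft_le_cright. Qed.
Let ltE x y : lt x y = (r x < l y). Proof. exact: canonical_ltE. Qed.
Let rm x : r x < m. Proof. exact: cright_lt. Qed.

(* With k = i (resp. k + 1 = i) this says that S is G_i together with a subset
   of R_i (resp. L_i). *)
Definition right_extender k S : bool := [forall x,
  ((l x < k <= r x) ==> (x \in S)) && ((x \in S) ==> (l x <= k <= r x))].
Definition left_extender k S : bool := [forall x,
  ((l x <= k < r x) ==> (x \in S)) && ((x \in S) ==> (l x <= k <= r x))].

Lemma right_extenderP k S : reflect
  ((forall x, l x < k <= r x -> x \in S) /\ (forall x, x \in S -> l x <= k <= r x))
  (right_extender k S).
Proof.
apply: (iffP forallP) => [H|[H1 H2] x].
  by split=> x; case/andP: (H x) => /implyP H1 /implyP H2.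
by apply/andP; split; apply/implyP; [exact: H1 | exact: H2].
Qed.

Lemma left_extenderP k S : reflect
  ((forall x, l x <= k < r x -> x \in S) /\ (forall x, x \in S -> l x <= k <= r x))
  (left_extender k S).
Proof.
apply: (iffP forallP) => [H|[H1 H2] x].
  by split=> x; case/andP: (H x) => /implyP H1 /implyP H2.
by apply/andP; split; apply/implyP; [exact: H1 | exact: H2].
Qed.

(** The guard in [gap_set] is automatic: l x < i makes i positive, and i <= r x < m. *)
Lemma mem_gap_set i x : (x \in gap_set lt i) = (l x < i <= r x).
Proof.
rewrite /gap_set; case: ifPn => [|H].
  by case: i => // i _; rewrite inE.
by rewrite inE; have := rm x; have := lr x; move: H; lia.
Qed.

(** Non-emptiness of S rules out i = 0 with L_i and i = m with R_i, where gap set and borderline set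
    are both empty; hence k ranges over exactly the m points. Conversely Z is S minus the gap
    set. *)
Lemma extendersP S : reflect
  (S != finset.set0 /\ exists2 k, k < m & right_extender k S || left_extender k S)
  (S \in extenders lt).
Proof.
rewrite inE; apply: (iffP andP) => -[S0].
  case/existsP=> i /existsP[Z /andP[Zi /eqP SE]]; split=> //.
  have [x0 x0S] := set0Pn _ S0.
  have SEx x : (x \in S) = (l x < i <= r x) || (x \in Z).
    by rewrite SE inE mem_gap_set.
  case/orP: Zi => /fintype.subsetP Zi.
    have ZE x : x \in Z -> (r x).+1 = i by move=> /Zi; rewrite inE => /eqP.
    have i0 : 0 < i.
      by have := SEx x0; rewrite x0S => /esym/orP[|/ZE]; lia.
    exists i.-1; first by have := ltn_ord i; lia.
    apply/orP; right; apply/left_extenderP; split=> x.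
      by move=> H; rewrite SEx; apply/orP; left; lia.
    by rewrite SEx => /orP[|/ZE]; have := lr x; lia.
  have ZE x : x \in Z -> l x = i by move=> /Zi; rewrite inE => /eqP.
  exists (i : nat).
    have := SEx x0; rewrite x0S => /esym/orP[|/ZE]; have := rm x0; have :=
      lr x0; lia.
  apply/orP; left; apply/right_extenderP; split=> x.
    by move=> H; rewrite SEx; apply/orP; left.
  by rewrite SEx => /orP[|/ZE]; have := lr x; lia.
case=> k km /orP[/right_extenderP|/left_extenderP] [H1 H2]; split=> //.
  have km' : k < m.+1 by lia.
  apply/existsP; exists (Ordinal km').
  apply/existsP; exists (S :\: gap_set lt k); apply/andP; split.
    apply/orP; right; apply/fintype.subsetP => x;
      rewrite !inE mem_gap_set /= => /andP[G /H2].
    by move: G; lia.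
  apply/eqP/setP=> x; rewrite !inE mem_gap_set /=.
  by case: (boolP (l x < k <= r x)) => [/H1|].
have km' : k.+1 < m.+1 by lia.
apply/existsP; exists (Ordinal km').
apply/existsP; exists (S :\: gap_set lt k.+1); apply/andP; split.
  apply/orP; left; apply/fintype.subsetP => x; rewrite !inE mem_gap_set /= =>
    /andP[G /H2].
  by move: G; lia.
apply/eqP/setP=> x; rewrite !inE mem_gap_set /=.
by case: (boolP (l x < k.+1 <= r x)) => [/H1|].
Qed.

(** Lets the program compare right endpoints although it only sees [lt]. An interval starting
    exactly at r w separates w from x if r x < r w, and it exists since every point is a left
    endpoint. *)
Lemma up_sub w x : (forall y, lt x y -> lt w y) <-> r w <= r x.
Proof.
split=> [H|wx y]; last by rewrite !ltE; exact: leq_ltn_trans.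
have [y yw] := ex_cleft canon (rm w).
by rewrite leqNgt; apply/negP=> xw; have := H y; rewrite !ltE yw xw ltnn =>
  /(_ isT).
Qed.

Lemma down_sub w x : (forall y, lt y x -> lt y w) <-> l x <= l w.
Proof.
split=> [H|wx y]; last by rewrite !ltE => /leq_trans; exact.
have [y yw] := ex_cright canon (cleft_lt canon w).
by rewrite leqNgt; apply/negP=> xw; have := H y; rewrite !ltE yw xw ltnn =>
  /(_ isT).
Qed.

Lemma mem_filling_sets_up w S :
  (S \in filling_sets (enum 'I_n) lt w) = left_extender (r w) S.
Proof.
rewrite mem_filling_sets ?enum_uniq //; last by move=> x; rewrite mem_enum.
apply: eq_forallb => x; rewrite /choices !all_rev.
have allE u v : all (fun y => lt u y ==> lt v y) (enum 'I_n) = (r v <= r u).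
  apply/allP/idP => [H|vu y _]; last by apply/implyP; apply/up_sub: y.
  by apply/up_sub => y uy; have := H y (mem_enum _ y); rewrite uy.
rewrite !allE ltE; have := lr x; have := lr w.
by do 3?case: ifP; rewrite !inE; case: (x \in S) => /=; lia.
Qed.

Lemma mem_filling_sets_down w S :
  (S \in filling_sets (enum 'I_n) (fun y x => lt x y) w) = right_extender (l w) S.
Proof.
rewrite mem_filling_sets ?enum_uniq //; last by move=> x; rewrite mem_enum.
apply: eq_forallb => x; rewrite /choices !all_rev.
have allE u v : all (fun y => lt y u ==> lt y v) (enum 'I_n) = (l u <= l v).
  apply/allP/idP => [H|vu y _]; last by apply/implyP; apply/down_sub: y.
  by apply/down_sub => y uy; have := H y (mem_enum _ y); rewrite uy.
rewrite !allE ltE; have := lr x; have := lr w.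
by do 3?case: ifP; rewrite !inE; case: (x \in S) => /=; lia.
Qed.

(** The program indexes by elements w instead of points k; nothing is lost, as every k is the right
    endpoint of some w and the left endpoint of another or the same one. *)
Lemma mem_found_extenders S : (S \in found (enum 'I_n) lt) = (S \in extenders lt).
Proof.
have e_mem x : x \in enum 'I_n by rewrite mem_enum.
rewrite mem_found ?enum_uniq //.
apply/andP/extendersP => -[S0].
  case/existsP => w; rewrite mem_filling_sets_up mem_filling_sets_down => H.
  split=> //; case/orP: H => H; first by exists (r w); rewrite ?H ?orbT.
  by exists (l w); rewrite ?H // (leq_ltn_trans (lr w)).
case=> k km H; split=> //; apply/existsP; case/orP: H => H.
  have [w wk] := ex_cleft canon km.
  by exists w; rewrite mem_filling_sets_down wk H orbT.
have [w wk] := ex_cright canon km.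
by exists w; rewrite mem_filling_sets_up wk H.
Qed.

Definition covers (s : seq {set 'I_n}) S : Prop :=
  forall x, count (fun A => x \in A) s = (x \in S).

(** If the index lies on the wrong side of k, a purely borderline element would miss k. Then S is a
    bare gap set, and such a set is an extender of both kinds, with indices differing by one. *)
Lemma extender_kind k S : S \in extenders lt ->
  (forall x, x \in S -> l x <= k <= r x) ->
  (exists2 j, j <= k & right_extender j S) \/
  (exists2 j, k <= j < m & left_extender j S).
Proof.
case/extendersP => _ [i im /orP[]] H Sk.
  have [ik|ki] := leqP i k; [by left; exists i | right].
  have /right_extenderP[H1 H2] := H.
  exists i.-1; first by lia.
  apply/left_extenderP; split=> x.
    by move=> xi; apply: H1; lia.
  by move=> xS; have := H2 x xS; have := Sk x xS; lia.
have [ki|ik] := leqP k i; [by right; exists i; rewrite ?ki | left].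
have /left_extenderP[H1 H2] := H.
exists i.+1; first by [].
apply/right_extenderP; split=> x.
  by move=> xi; apply: H1; lia.
by move=> xS; have := H2 x xS; have := Sk x xS; lia.
Qed.

(** If j < j', every element of A starts by j and reaches k >= j', so it lies in the gap set at j'
    and hence in B. Disjointness thus forces j = j', and a union at a common index is immediate. *)
Lemma right_extenders_union j j' k A B : k < m -> j <= k -> j' <= k ->
  right_extender j A -> right_extender j' B ->
  A != finset.set0 -> B != finset.set0 -> [disjoint A & B] ->
  (forall x, x \in A :|: B -> l x <= k <= r x) -> A :|: B \in extenders lt.
Proof.
wlog le : j j' A B / j <= j'.
  move=> W km jk jk' HA HB A0 B0 dAB Sk; have [le|/ltnW le] := leqP j j'.
    exact: W HA HB _ _ _ _.
  by rewrite finset.setUC; apply: W HB HA _ _ _ _ => //;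
    rewrite 1?disjoint_sym 1?finset.setUC.
move=> km jk jk' /right_extenderP[A1 A2] /right_extenderP[B1 B2] /set0Pn[x xA]
  B0 dAB Sk.
have xB : x \notin B by rewrite (disjointFr dAB xA).
have {le} jj : j = j'.
  apply/eqP; rewrite eqn_leq le leqNgt; apply: contra xB => lt_jj; apply: B1.
  have := A2 x xA; have := Sk x; rewrite inE xA => /(_ isT); lia.
rewrite -{}jj in B1 B2.
apply/extendersP; split; first by apply/set0Pn; exists x; rewrite inE xA.
exists j; first exact: leq_ltn_trans km.
apply/orP; left; apply/right_extenderP; split=> y; first by move/A1;
  rewrite inE => ->.
by rewrite inE => /orP[/A2|/B2].
Qed.

Lemma left_extenders_union j j' k A B : j < m -> j' < m -> k <= j -> k <= j' ->
  left_extender j A -> left_extender j' B ->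
  A != finset.set0 -> B != finset.set0 -> [disjoint A & B] ->
  (forall x, x \in A :|: B -> l x <= k <= r x) -> A :|: B \in extenders lt.
Proof.
wlog le : j j' A B / j' <= j.
  move=> W jm jm' jk jk' HA HB A0 B0 dAB Sk; have [le|/ltnW le] := leqP j' j.
    exact: W HA HB _ _ _ _.
  by rewrite finset.setUC; apply: W HB HA _ _ _ _ => //;
    rewrite 1?disjoint_sym 1?finset.setUC.
move=> jm jm' jk jk' /left_extenderP[A1 A2] /left_extenderP[B1 B2] /set0Pn[x
  xA] B0 dAB Sk.
have xB : x \notin B by rewrite (disjointFr dAB xA).
have {le} jj : j = j'.
  apply/eqP; rewrite eqn_leq le andbT leqNgt; apply: contra xB => lt_jj; apply: B1.
  have := A2 x xA; have := Sk x; rewrite inE xA => /(_ isT); lia.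
rewrite -{}jj in B1 B2.
apply/extendersP; split; first by apply/set0Pn; exists x; rewrite inE xA.
exists j => //.
apply/orP; right; apply/left_extenderP; split=> y; first by move/A1;
  rewrite inE => ->.
by rewrite inE => /orP[/A2|/B2].
Qed.

(* Relative to a point k common to all intervals involved, every extender is a
   right extender at some j <= k or a left extender at some j >= k, and two
   disjoint ones of the same kind have the same j. *)
Lemma extenders_union3 k A B C : k < m ->
  (forall D x, D \in [:: A; B; C] -> x \in D -> l x <= k <= r x) ->
  {subset [:: A; B; C] <= extenders lt} ->
  [disjoint A & B] -> [disjoint A & C] -> [disjoint B & C] ->
  [|| A :|: B \in extenders lt, A :|: C \in extenders lt |
      B :|: C \in extenders lt].
Proof.
move=> km Sk sE dAB dAC dBC.
have kind D : D \in [:: A; B; C] ->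
  (exists2 j, j <= k & right_extender j D) \/
  (exists2 j, k <= j < m & left_extender j D).
  by move=> D_in; apply: extender_kind (sE _ D_in) _ => x; exact: Sk.
have nE D : D \in [:: A; B; C] -> D != finset.set0 by move/sE; case/extendersP.
have SkU D D' : D \in [:: A; B; C] -> D' \in [:: A; B; C] ->
    forall x, x \in D :|: D' -> l x <= k <= r x.
  by move=> D_in D'_in x; rewrite inE => /orP[]; exact: Sk.
have A_in : A \in [:: A; B; C] by rewrite !inE eqxx.
have B_in : B \in [:: A; B; C] by rewrite !inE eqxx orbT.
have C_in : C \in [:: A; B; C] by rewrite !inE eqxx !orbT.
have right2 D D' : D \in [:: A; B; C] -> D' \in [:: A; B; C] -> [disjoint D & D'] ->
    (exists2 j, j <= k & right_extender j D) ->
    (exists2 j, j <= k & right_extender j D') -> D :|: D' \in extenders lt.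
  move=> D_in D'_in dis [j jk H] [j' jk' H'].
  exact: right_extenders_union km jk jk' H H' (nE _ D_in) (nE _ D'_in) dis (SkU
    _ _ D_in D'_in).
have left2 D D' : D \in [:: A; B; C] -> D' \in [:: A; B; C] -> [disjoint D & D'] ->
    (exists2 j, k <= j < m & left_extender j D) ->
    (exists2 j, k <= j < m & left_extender j D') -> D :|: D' \in extenders lt.
  move=> D_in D'_in dis [j /andP[jk jm] H] [j' /andP[jk' jm'] H'].
  exact: left_extenders_union jm jm' jk jk' H H' (nE _ D_in) (nE _ D'_in) dis
    (SkU _ _ D_in D'_in).
case: (kind A A_in) => kA; case: (kind B B_in) => kB; case: (kind C C_in) => kC;
  first [by rewrite (right2 A B) | by rewrite (left2 A B)
    | by rewrite (right2 A C) ?orbT | by rewrite (left2 A C) ?orbT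
    | by rewrite (right2 B C) ?orbT | by rewrite (left2 B C) ?orbT].
Qed.

(** All members lie inside the extender S and so share its point k. While at least three remain, two
    of the first three can be merged; the process stops at exactly two. *)
Lemma covers_set_sum s S : covers s S -> {subset s <= extenders lt} ->
  S \in extenders lt -> 1 < size s ->
  exists A B, [/\ A \in extenders lt, B \in extenders lt & set_sum A B S].
Proof.
move=> cS sE /extendersP[S0 [k km Sk]].
have {}Sk x : x \in S -> l x <= k <= r x.
  by case/orP: Sk => [/right_extenderP|/left_extenderP] [_]; apply.
have [N] := ubnP (size s); elim: N s => // N IH s in cS sE *.
have disj A B : (forall x, (x \in A) + (x \in B) <= (x \in S)) -> [disjoint A & B].
  move=> H; rewrite disjoint_subset; apply/fintype.subsetP => x xA; rewrite inE.
  by have := H x; rewrite xA; case: (x \in B) (x \in S) => -[].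
case: s => [|A [|B [|C s]]] // in cS sE *; rewrite ltnS => sN _.
  exists A, B; split; try by apply: sE; rewrite !inE eqxx ?orbT.
  apply/andP; split; first by apply: disj => x; rewrite -cS /= addn0.
  apply/eqP/setP => x; have := cS x; rewrite /= inE.
  by case: (x \in A) (x \in B) (x \in S) => -[] [].
have cS' x : (x \in A) + ((x \in B) + ((x \in C) + count (fun A =>
  x \in A) s)) = (x \in S).
  exact: cS.
have dAB : [disjoint A & B] by apply: disj => x; have := cS' x; lia.
have dAC : [disjoint A & C] by apply: disj => x; have := cS' x; lia.
have dBC : [disjoint B & C] by apply: disj => x; have := cS' x; lia.
have card_union (D D' : {set 'I_n}) x : [disjoint D & D'] ->
  (x \in D :|: D') = (x \in D) + (x \in D') :> nat.
  move=> dis; rewrite inE; case: (boolP (x \in D)) => //= xD.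
  by rewrite (disjointFr dis xD).
have s3E : {subset [:: A; B; C] <= extenders lt}.
  by move=> D D_in; apply: sE; move: D_in; rewrite !inE => /or3P[] ->;
    rewrite ?orbT.
have ssE : {subset s <= extenders lt}.
  by move=> D D_in; apply: sE; rewrite !inE D_in !orbT.
have s3S D x : D \in [:: A; B; C] -> x \in D -> l x <= k <= r x.
  move=> D_in xD; apply: Sk; have := cS' x; move: D_in xD; rewrite !inE.
  by case/or3P => /eqP-> ->; case: (x \in S) => //; lia.
case/or3P: (extenders_union3 km s3S s3E dAB dAC dBC) => UE.
- apply: (IH [:: A :|: B, C & s]) => //.
    by move=> x; rewrite /= card_union // -cS' !addnA.
  by move=> D; rewrite 2!in_cons => /or3P[/eqP->|/eqP->|/ssE] //; apply: s3E;
    rewrite !inE eqxx ?orbT.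
- apply: (IH [:: A :|: C, B & s]) => //.
    by move=> x; rewrite /= card_union // -cS' -addnA; congr addn; rewrite addnCA.
  by move=> D; rewrite 2!in_cons => /or3P[/eqP->|/eqP->|/ssE] //; apply: s3E;
    rewrite !inE eqxx ?orbT.
- apply: (IH [:: B :|: C, A & s]) => //.
    by move=> x; rewrite /= card_union // -cS' addnCA -addnA.
  by move=> D; rewrite 2!in_cons => /or3P[/eqP->|/eqP->|/ssE] //; apply: s3E;
    rewrite !inE eqxx ?orbT.
Qed.

Definition irreducible_extender S : bool :=
  (S \in extenders lt) && ~~ splits (found (enum 'I_n) lt) S.

Lemma splits_foundP S : reflect
  (exists A B, [/\ A \in extenders lt, B \in extenders lt & set_sum A B S])
  (splits (found (enum 'I_n) lt) S).
Proof.
apply: (iffP hasP) => [[A AE /hasP[B BE AB]]|[A [B [AE BE AB]]]].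
  by exists A, B; rewrite -!mem_found_extenders.
exists A; first by rewrite mem_found_extenders.
by apply/hasP; exists B; first by rewrite mem_found_extenders.
Qed.

Lemma irreducible_covers S : S \in extenders lt ->
  exists2 s, covers s S & all irreducible_extender s.
Proof.
have [N] := ubnP #|S|; elim: N S => // N IH S; rewrite ltnS => SN SE.
case: (boolP (splits (found (enum 'I_n) lt) S)) => [|nS]; last first.
  by exists [:: S]; [move=> x; rewrite /= addn0 | rewrite /= andbT; apply/andP].
case/splits_foundP => A [B [AE BE /andP[dAB /eqP SU]]].
have cU : #|S| = #|A| + #|B| by rewrite SU cardsU disjoint_setI0 // cards0 subn0.
have A0 : 0 < #|A| by rewrite card_gt0; case/extendersP: AE.
have B0 : 0 < #|B| by rewrite card_gt0; case/extendersP: BE.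
have [|sA cA iA] := IH A _ AE; first by lia.
have [|sB cB iB] := IH B _ BE; first by lia.
exists (sA ++ sB); last by rewrite all_cat iA.
move=> x; rewrite count_cat cA cB SU inE.
case: (boolP (x \in A)) => // xA.
by rewrite (disjointFr dAB xA).
Qed.
End Extenders.

(** * The Hilbert basis *)

Section Slices.
Local Open Scope nat_scope.
Variables (n : nat) (lt : rel 'I_n).
Hypothesis canon : exists lr : {ffun 'I_n -> nat} * {ffun 'I_n -> nat},
  canonical_rep lt lr.1 lr.2.
Notation l := (cleft lt).
Notation r := (cright lt).
Notation m := (magnitude lt).
Variables l' r' : 'I_n -> nat.
Hypothesis rep : natural_rep lt l' r'.

Let lr x : l x <= r x. Proof. exact: cleft_le_cright. Qed.
Let rm x : r x < m. Proof. exact: cright_lt. Qed.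
Let lr' x : l' x <= r' x. Proof. by case: rep. Qed.

Let before x y : r x < l y -> r' x < l' y.
Proof. by rewrite -(canonical_ltE canon) => xy; case: rep => _ H; apply/H. Qed.

Let meet x y : l y <= r x -> l' y <= r' x.
Proof.
move=> yx; rewrite leqNgt; apply/negP => H.
have : lt x y by case: rep => _ E; apply/E.
by rewrite canonical_ltE // ltnNge yx.
Qed.

Definition slice t : {set 'I_n} := [set x | l' x <= t < r' x]%SET.

(* The index of the extender is the least canonical left endpoint of an
   interval that starts after t. *)
Lemma slice_extender t : slice t != finset.set0 -> slice t \in extenders lt.
Proof.
move=> S0; apply/(extendersP canon); split=> //.
(* The value m stands for the case that no interval starts after t. *)
pose P b := (b == m) || [exists y, (l y == b) && (t < l' y)].
have exP : exists b, P b by exists m; rewrite /P eqxx.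
case: (ex_minnP exP) => b Pb b_min {exP}.
have b_le : b <= m by apply: b_min; rewrite /P eqxx.
have started x : l x < b -> l' x <= t.
  move=> xb; rewrite leqNgt; apply/negP => tx.
  have : b <= l x by apply: b_min; rewrite /P; apply/orP; right; apply/existsP;
    exists x; rewrite eqxx.
  by rewrite leqNgt xb.
have waiting : b < m -> exists2 y, l y = b & t < l' y.
  move=> bm; move: Pb; rewrite /P ltn_eqF //= => /existsP[y /andP[/eqP <- ty]].
  by exists y.
have gap x : l x < b <= r x -> x \in slice t.
  case/andP=> xb bx; rewrite inE started //=.
  have [y yb ty] := waiting (leq_ltn_trans bx (rm x)).
  by apply: leq_trans ty (meet _); rewrite yb.
have late x : x \in slice t -> l x <= b.
  rewrite inE => /andP[xt _]; rewrite leqNgt; apply/negP => bx.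
  have bm : b < m by apply: ltn_trans bx (leq_ltn_trans (lr x) (rm x)).
  have [y yb ty] := waiting bm.
  have [w wb] := ex_cright canon bm.
  have := before (x := w) (y := x); rewrite wb => /(_ bx).
  by have := @meet w y; rewrite wb yb => /(_ (leqnn _)); lia.
have early x : x \in slice t -> b <= (r x).+1.
  rewrite inE => /andP[_ tx]; rewrite leqNgt; apply/negP => xb.
  have [z zb] : exists z, l z = b.-1 by apply: (ex_cleft canon); lia.
  have := @before x z; rewrite zb => H.
  have : l' z <= t by apply: started; lia.
  have : r' x < l' z by apply: H; lia.
  by lia.
(* Two such elements would be comparable although both contain the step; so the slice meets only one
   kind of borderline elements, which decides between left and right extender. *)
have one_side x y : x \in slice t -> y \in slice t -> r x < b -> b <= l y -> False.
  rewrite !inE => /andP[_ tx] /andP[yt _] xb by_.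
  by have := before (leq_trans xb by_); lia.
have [/existsP[x /andP[xS xb]]|/existsPn H] := boolP [exists x in slice t, r x < b].
  exists b.-1; first by lia.
  apply/orP; right; apply/left_extenderP; split=> y.
    by move=> yb; apply: gap; lia.
  move=> yS; have := early y yS; have := late y yS; have := one_side x y xS yS xb.
  have := lr y; case: (leqP b (l y)) => [_ _|]; last by lia.
  by move/(_ isT).
have ge x : x \in slice t -> b <= r x.
  by move=> xS; have := H x; rewrite xS /= -leqNgt.
have [x xS] := set0Pn _ S0.
exists b; first by apply: leq_ltn_trans (ge x xS) (rm x).
apply/orP; left; apply/right_extenderP; split=> // y yS.
by rewrite late // ge.
Qed.

Definition cut i := \max_(x | r x < i) r' x.

(** At time [cut i] every interval canonically ending before i has ended, and none canonically
    starting at i or later has begun: such a start comes after all those ends. *)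
Lemma slice_cut i : 0 < i < m -> slice (cut i) = gap_set lt i.
Proof.
case/andP=> i0 im; apply/setP=> x; rewrite inE mem_gap_set //.
have cut_lt y : i <= l y -> cut i < l' y.
  move=> iy; have [z _] := ex_cleft canon im.
  have l'0 : 0 < l' y.
    have [w wi] : exists w, r w = i.-1 by apply: (ex_cright canon); lia.
    have : r' w < l' y by apply: before; lia.
    by lia.
  rewrite -(prednK l'0) ltnS; apply/bigmax_leqP => w wi.
  have : r' w < l' y by apply: before; lia.
    by lia.
have le_cut w : r w < i -> r' w <= cut i.
  exact: (@leq_bigmax_cond _ _ r' w).
apply/andP/andP => -[H1 H2]; split.
- by rewrite ltnNge; apply/negP => /cut_lt; lia.
- by rewrite leqNgt; apply/negP => /le_cut; lia.
- have [w wi] : exists w, r w = i.-1 by apply: (ex_cright canon); lia.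
  have : r' w <= cut i by apply: le_cut; lia.
  have : l' x <= r' w by apply: meet; lia.
    by lia.
- have [y yi] := ex_cleft canon im.
  have : l' y <= r' x by apply: meet; lia.
  by have := cut_lt y; rewrite yi leqnn => /(_ isT); lia.
Qed.

Lemma cut_lt_right i x : 0 < i -> i <= r x -> cut i < r' x.
Proof.
move=> i0 ix; have im : i < m by apply: leq_ltn_trans ix (rm x).
have [y yi] := ex_cleft canon im.
have lex : l' y <= r' x by apply: meet; lia.
have gt w : r w < i -> r' w < r' x.
  by move=> wi; apply: leq_trans lex; apply: before; rewrite yi.
have [w wi] : exists w, r w = i.-1 by apply: (ex_cright canon); lia.
have x0 : 0 < r' x by have := gt w; lia.
rewrite -(prednK x0) ltnS; apply/bigmax_leqP => v /gt; lia.
Qed.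

(** Distinct gap sets occupy distinct unit steps, so they can be split off from the sum of all
    slices together. *)
Lemma cut_lt i j : 0 < i < j -> j <= m -> cut i < cut j.
Proof.
case/andP=> i0 ij jm.
have [x xi] : exists x, r x = i by apply: (ex_cright canon); lia.
apply: leq_trans (cut_lt_right i0 _) (_ : r' x <= _); first by rewrite xi.
by apply: (@leq_bigmax_cond _ (fun x => r x < j) r' x); rewrite xi.
Qed.
End Slices.

Lemma sum_interval a b N : (a <= b <= N)%N ->
  (\sum_(0 <= t < N) (a <= t < b) = b - a)%N.
Proof.
have -> : (\sum_(0 <= t < N) (a <= t < b) = minn b N - minn a N)%N.
  elim: N => [|N IH]; first by rewrite big_nil !minn0.
  by rewrite big_nat_recr //= IH; lia.
by lia.
Qed.

(** * Excess lengths as sums of extenders *)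

Section Decomposition.
Variables (n : nat) (lt : rel 'I_n).
Hypothesis canon : exists lr : {ffun 'I_n -> nat} * {ffun 'I_n -> nat},
  canonical_rep lt lr.1 lr.2.
Notation l := (cleft lt).
Notation r := (cright lt).
Notation m := (magnitude lt).

Definition indicator (S : {set 'I_n}) : 'rV[int]_n := \row_x (x \in S)%:R.
Definition indicators (s : seq {set 'I_n}) : 'rV[int]_n :=
  \sum_(S <- s) indicator S.

Lemma indicatorsE s x : indicators s 0 x = (count (fun S : {set 'I_n} =>
  x \in S) s)%:R.
Proof.
rewrite /indicators summxE -sum1_count natr_sum [RHS]big_mkcond.
by apply: eq_bigr => S _; rewrite mxE /=; case: (x \in S).
Qed.

Lemma indicators_cat s s' : indicators (s ++ s') = indicators s + indicators s'.
Proof. exact: big_cat. Qed.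

(* Every unit step contributes its slice to the lengths; those at the cuts
   account for the canonical representation. *)
Lemma natural_rep_decomposition l' r' : natural_rep lt l' r' ->
  exists2 s, {subset s <= extenders lt} &
    indicators s = \row_x ((r' x - l' x)%N%:Z - (r x - l x)%N%:Z).
Proof.
move=> rep; have lr' x : (l' x <= r' x)%N by case: rep.
pose N := \max_x r' x.
pose I := index_iota 1 m.
pose cuts := map (cut lt r') I.
have r'N x : (r' x <= N)%N by exact: leq_bigmax.
have cuts_uniq : uniq cuts.
  rewrite map_inj_in_uniq ?iota_uniq // => i j.
  rewrite !mem_index_iota => /andP[i0 im] /andP[j0 jm] E.
  case: (ltngtP i j) => // [ij|ji].
    by have := cut_lt canon rep (i := i) (j := j); rewrite E i0 ij ltnn;
      move/(_ isT (ltnW jm)).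
  by have := cut_lt canon rep (i := j) (j := i); rewrite E j0 ji ltnn;
    move/(_ isT (ltnW im)).
have cuts_lt : {subset cuts <= iota 0 N}.
  move=> t /mapP[i]; rewrite mem_index_iota => /andP[i0 im] ->.
  have [x xi] := ex_cright canon im.
  rewrite mem_iota /= add0n; apply: leq_trans (r'N x).
  by apply: (cut_lt_right canon rep); rewrite ?xi.
pose ts := [seq t <- iota 0 N | t \notin cuts].
pose s := [seq S <- map (slice l' r') ts | S != finset.set0].
exists s.
  move=> S; rewrite mem_filter => /andP[S0 /mapP[t _ SE]].
  by rewrite SE; apply: (slice_extender canon rep); rewrite -SE.
have perm : perm_eq (iota 0 N) (cuts ++ ts).
  rewrite -(perm_filterC (mem cuts)) perm_sym.
  apply: perm_cat => //; apply: uniq_perm => //;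
    first by rewrite filter_uniq ?iota_uniq.
  move=> t; rewrite mem_filter /=; case E: (t \in cuts) => //=.
  by rewrite cuts_lt.
have sE : indicators s = \sum_(t <- ts) indicator (slice l' r' t).
  rewrite /indicators big_filter big_map big_mkcond /=.
  apply: eq_bigr => t _; case: eqP => //= ->.
  by apply/rowP=> x; rewrite !mxE inE.
have /(congr1 (fun v => v - \sum_(i <- I) indicator (gap_set lt i))) :
  \sum_(t <- iota 0 N) indicator (slice l' r' t) =
  \sum_(i <- I) indicator (gap_set lt i) + indicators s.
  rewrite (perm_big _ perm) big_cat sE; congr (_ + _).
  rewrite big_map; apply: eq_big_seq => i; rewrite mem_index_iota => im.
  by rewrite (slice_cut canon rep).
rewrite [X in _ = X]addrAC subrr add0r => <-.
apply/rowP=> x; rewrite !mxE !summxE; congr (_ - _).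
  rewrite -(@sum_interval _ _ N) ?lr' ?r'N // -[Posz _]natz natr_sum.
  by rewrite /index_iota subn0; apply: eq_bigr => t _; rewrite !mxE inE.
have xm : (r x < m)%N by apply: cright_lt.
(* x belongs to the gap set at i exactly for l x + 1 <= i < r x + 1; the index 0 of [sum_interval]
   contributes nothing. *)
have -> : (r x - l x = (r x).+1 - (l x).+1)%N by rewrite subSS.
rewrite -(@sum_interval _ _ m) ?ltnS ?cleft_le_cright // -[Posz _]natz natr_sum.
rewrite (big_ltn (leq_ltn_trans _ xm)) // add0r.
by apply: eq_bigr => i _; rewrite !mxE mem_gap_set.
Qed.
End Decomposition.

(** * The irreducible extenders as minimal basis *)

Section HilbertBasis.
Variables (R : realType) (n : nat) (lt : rel 'I_n).
Hypothesis canon : exists lr : {ffun 'I_n -> nat} * {ffun 'I_n -> nat},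
  canonical_rep lt lr.1 lr.2.
Notation l := (cleft lt).
Notation r := (cright lt).
Notation m := (magnitude lt).
Notation C := (length_cone R lt).
Notation E := (extenders lt).
Implicit Types (S A B : {set 'I_n}) (x y : 'I_n) (z g h : 'rV[int]_n).

Lemma natural_rep_cone l' r' S : natural_rep lt l' r' ->
  (forall x, r' x + l x = r x + l' x + (x \in S))%N ->
  C (map_mx intr (indicator S)).
Proof.
case=> lr' ltE len; exists (\row_x ((r' x)%:R - (l' x)%:R)).
  exists (fun x => (l' x)%:R), (fun x => (r' x)%:R); split=> //; split.
  - by move=> x; rewrite ler_nat.
  - by move=> x y; rewrite ltr_nat; exact: ltE.
  - by move=> x y /ltE xy; rewrite natr1 ler_nat.
apply/rowP=> x; rewrite !mxE /=.
have /(congr1 (fun k => k%:R : R)) := len x; rewrite !natrD => lenR.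
have -> : (((x \in S)%:R : int)%:~R : R) = (x \in S)%:R by case: (x \in S).
by lra.
Qed.

Lemma extender_cone S : S \in E -> C (map_mx intr (indicator S)).
Proof.
have lr x : (l x <= r x)%N by exact: cleft_le_cright.
have ltE x y : lt x y = (r x < l y)%N by exact: canonical_ltE.
case/(extendersP canon) => _ [k km /orP[/right_extenderP|/left_extenderP]] [H1 H2].
  (* The point k is doubled. All ends at k or later and all starts at k or later move up by one,
     except that elements of S starting at k keep the first copy. In the dual case below, elements
     of S ending at k are prolonged to the second copy. *)
  apply: (@natural_rep_cone (fun x => l x + ((k <= l x) && (x \notin S)))%N
                            (fun x => r x + (k <= r x))%N).
    split=> [x|x y]; first by have := lr x; have := H1 x; case: (x \in S) =>
      /=; lia.
    rewrite ltE; have := lr x; have := lr y; have := H2 y.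
    by case: (y \in S) => /=; lia.
  move=> x; have := lr x; have := H1 x; have := H2 x.
  by case: (x \in S) => /=; lia.
apply: (@natural_rep_cone (fun x => l x + (k < l x))%N
                          (fun x => r x + ((k < r x) || (x \in S)))%N).
  split=> [x|x y]; first by have := lr x; lia.
  rewrite ltE; have := lr x; have := lr y; have := H2 x.
  by case: (x \in S) => /=; lia.
move=> x; have := lr x; have := H1 x; have := H2 x.
by case: (x \in S) => /=; lia.
Qed.

(* Rounding down the endpoints of a real representation with integral lengths
   preserves both kinds of constraints. *)
Lemma cone_natural_rep z : C (map_mx intr z) ->
  exists l' r', natural_rep lt l' r' /\
    z = \row_x ((r' x - l' x)%N%:Z - (r x - l x)%N%:Z).
Proof.
have lr x : (l x <= r x)%N by exact: cleft_le_cright.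
case=> _ [l0 [r0 [[lr0 ltE0 gap0] ->]]] vz.
pose fl x : int := Num.floor (l0 x); pose fr x : int := Num.floor (r0 x).
have frE x : fr x = fl x + (z 0 x + (r x - l x)%N%:Z).
  have := congr1 (fun v : 'rV[R]_n => v 0 x) vz; rewrite !mxE /= => e.
  have -> : fr x = Num.floor (l0 x + (z 0 x + (r x - l x)%N%:Z)%:~R).
    congr Num.floor; rewrite intrD -e -[in RHS]pmulrn natrB //; lra.
  by rewrite floorDrz ?intr_int // intrKfloor.
(* Translation by N makes all rounded endpoints non-negative without changing lengths. *)
pose N := (\sum_x `|fl x|)%N.
have flN x : 0 <= fl x + N%:Z.
  have : (`|fl x| <= N)%N by rewrite /N (bigD1 x) //= leq_addr.
  by lia.
have lrf x : fl x <= fr x by exact: le_floor.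
(* The unit gap is what survives rounding: r < l alone would only give a weak inequality of the
   floors. *)
have ltf x y : lt x y <-> fr x < fl y.
  split=> [/gap0 /(@le_floor R)|];
    first by rewrite floorDrz ?rpred1 // floor1 -/(fr x) -/(fl y); lia.
  move=> H; apply/ltE0; rewrite ltNge; apply/negP => /(@le_floor R).
  by rewrite leNgt H.
exists (fun x => absz (fl x + N%:Z)), (fun x => absz (fr x + N%:Z)); split.
  split=> [x|x y]; first by have := flN x; have := lrf x; lia.
  have Nx := flN x; have Ny := flN y; have Lx := lrf x; have Ly := lrf y.
  by split=> [/ltf xy|xy]; [lia | apply/ltf; lia].
apply/rowP=> x; rewrite mxE; have := flN x; have := lrf x; have := frE x; lia.
Qed.

Lemma cone_indicators z : C (map_mx intr z) ->
  exists2 s, {subset s <= E} & indicators s = z.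
Proof.
case/cone_natural_rep => l' [r' [rep ->]].
exact: (natural_rep_decomposition canon rep).
Qed.

Lemma indicator_inj : injective (@indicator n).
Proof.
move=> A B AB; apply/setP => x; have := congr1 (fun v : 'rV[int]_n => v 0 x) AB.
by rewrite !mxE; case: (x \in A); case: (x \in B).
Qed.

Lemma indicators_covers s S : indicators s = indicator S -> covers s S.
Proof.
move=> e x; have := congr1 (fun v : 'rV[int]_n => v 0 x) e.
by rewrite indicatorsE mxE !natz => -[].
Qed.

Lemma covers_indicators s S : covers s S -> indicators s = indicator S.
Proof. by move=> c; apply/rowP=> x; rewrite indicatorsE mxE c. Qed.

Lemma sum_count_mem (T : choiceType) (V : nmodType) (F : T -> V) (H : {fset T}) t :
  {subset t <= H} -> \sum_(h <- H) F h *+ count_mem h t = \sum_(h <- t) F h.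
Proof.
elim: t => [|a t IH] tH; first by rewrite big_nil big1.
rewrite big_cons -IH; last by move=> h ht; apply: tH; rewrite inE ht orbT.
under eq_bigr => h _ do rewrite /= mulrnDr.
rewrite big_split /=; congr (_ + _).
have aH : a \in H by apply: tH; rewrite inE eqxx.
rewrite (bigD1_seq a) ?fset_uniq //= eqxx mulr1n big1 ?addr0 // => h ha.
by rewrite eq_sym (negbTE ha).
Qed.

Variable basis : seq {set 'I_n}.
Hypothesis mem_basis : forall S, (S \in basis) = irreducible_extender lt S.
Let H0 : {fset 'rV[int]_n} := [fset v in map (@indicator n) basis]%fset.

Let mem_H0 S : S \in basis -> indicator S \in H0.
Proof. by move=> Sb; rewrite inE /= map_f. Qed.

Lemma irreducible_hilbert_basis : hilbert_basis C H0.
Proof.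
split=> [h|z].
  rewrite inE => /mapP[S]; rewrite mem_basis => /andP[SE _] ->.
  exact: extender_cone.
case/cone_indicators => s sE <- {z}.
have [s' s'H <-] : exists2 s', {subset map (@indicator n) s' <= H0} &
  indicators s' = indicators s.
  elim: s sE => [|S s IH] sE; first by exists [::].
  have [|s' s'H s's] := IH; first by move=> A As; apply: sE; rewrite inE As orbT.
  have [|t tS irr_t] := irreducible_covers canon (S := S); first by apply: sE;
    rewrite inE eqxx.
  exists (t ++ s'); last first.
    by rewrite indicators_cat s's (covers_indicators tS) /indicators big_cons.
  move=> v; rewrite map_cat mem_cat => /orP[/mapP[A At ->]|/s'H //].
  by apply: mem_H0; rewrite mem_basis (allP irr_t).
exists (fun h => count_mem h (map (@indicator n) s')).
by rewrite (sum_count_mem id s'H) big_map.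
Qed.

(** Expand the indicator of S over H, single out one copy of a non-zero h that occurs, and decompose
    h and the remainder into extenders. The two lists together partition S, so irreducibility leaves
    at most one member; as h is non-zero, it takes that member and equals the indicator. *)
Lemma hilbert_basis_sub H : hilbert_basis C H -> (H0 `<=` H)%fset.
Proof.
case=> HC Hgen; apply/fsubsetP => h; rewrite inE => /mapP[S].
rewrite mem_basis => /andP[SE nS] -> {h}.
have [c Sc] := Hgen _ (extender_cone SE).
have S0 : indicator S != 0.
  case/(extendersP canon): SE => /set0Pn[x xS] _; apply/eqP => e.
  by have := congr1 (fun v : 'rV[int]_n => v 0 x) e; rewrite !mxE xS.
have [h [hH ch h0]] : exists h, [/\ h \in H, (0 < c h)%N & h != 0].
  apply: contrapT => no; case/eqP: S0; rewrite Sc big_seq big1 // => h hH.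
  case: (posnP (c h)) => [->|ch]; first by rewrite mulr0n.
  have [->|h0] := eqVneq h 0; first by rewrite mul0rn.
  by case: no; exists h.
have comb g : g \in H -> forall k, exists2 s, {subset s <= E} &
  indicators s = g *+ k.
  move=> /HC /cone_indicators[s sE <-]; elim=> [|k [t tE e]].
    by exists [::] => //; rewrite mulr0n /indicators big_nil.
  exists (s ++ t); last by rewrite indicators_cat e mulrS.
  by move=> A; rewrite mem_cat => /orP[/sE|/tE].
have [s1 s1E e1] := cone_indicators (HC h hH).
have [s2 s2E e2] : exists2 s, {subset s <= E} &
    indicators s = h *+ (c h).-1 + \sum_(g <- H | g != h) g *+ c g.
  have [t tE te] := comb h hH (c h).-1.
  have [t' t'E t'e] : exists2 s, {subset s <= E} &
      indicators s = \sum_(g <- H | g != h) g *+ c g.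
    rewrite big_seq_cond; apply: (big_ind (fun v =>
      exists2 s, {subset s <= E} & indicators s = v)).
    - by exists [::] => //; rewrite /indicators big_nil.
    - move=> v w [s sE <-] [s' s'E <-]; exists (s ++ s');
      last exact: indicators_cat.
      by move=> A; rewrite mem_cat => /orP[/sE|/s'E].
    - by move=> g /andP[gH _]; exact: comb.
  exists (t ++ t'); last by rewrite indicators_cat te t'e.
  by move=> A; rewrite mem_cat => /orP[/tE|/t'E].
have cS : covers (s1 ++ s2) S.
  apply: indicators_covers; rewrite indicators_cat e1 e2 Sc.
  by rewrite [RHS](bigD1_seq h) ?fset_uniq //= addrA -mulrS prednK.
have sz : (size (s1 ++ s2) <= 1)%N.
  rewrite leqNgt; apply: contra nS => sz; apply/(splits_foundP canon).
  apply: (covers_set_sum canon cS) => // A.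
  by rewrite mem_cat => /orP[/s1E|/s2E].
case: s1 e1 {s1E} => [|A s1] e1 in sz cS *.
  by rewrite -e1 /indicators big_nil eqxx in h0.
case: s1 s2 {s2E e2} => [|? ?] // [|? ?] // in sz cS e1 *.
have -> : indicator S = h.
  rewrite -e1 /indicators big_seq1; congr indicator; apply/setP=> x.
  by have := cS x; rewrite /= addn0; case: (x \in A) (x \in S) => -[].
by [].
Qed.

Lemma minimal_hilbert_basis_unique : unique (minimal_hilbert_basis C) H0.
Proof.
split=> [|H [HC Hmin]]; last first.
  by apply: Hmin irreducible_hilbert_basis (hilbert_basis_sub HC).
split=> [|H /hilbert_basis_sub sub sub']; first exact: irreducible_hilbert_basis.
by apply/eqP; rewrite eqEfsubset sub sub'.
Qed.
End HilbertBasis.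

(** * Agreement of the encodings, and the theorem *)

Lemma encode_orderE n (lt : rel 'I_n) :
  encode_order lt = encode_mx (mx_of lt (enum 'I_n) (enum 'I_n)).
Proof.
rewrite /encode_mx encode_seq_map /encode_order /encode_seq; congr foldr.
by apply/funext => x; apply/funext => t; rewrite /encode_row encode_seq_map.
Qed.

Lemma encode_vector_indicator n (S : {set 'I_n}) :
  encode_vector (indicator S) = encode_set (enum 'I_n) S.
Proof.
rewrite /encode_set /encode_bits encode_seq_map /encode_vector /encode_seq.
congr foldr; apply/funext => x; congr Node.
by rewrite mxE; case: (x \in S).
Qed.

Theorem corollary6p7 (R : realType)
    (K : forall n : nat, rel 'I_n -> Prop)
    (K_interval : forall (n : nat) (lt : rel 'I_n),
       K n lt -> interval_order R lt)
    (p : {poly R})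
    (K_extenders : forall (n : nat) (lt : rel 'I_n),
       K n lt -> #|extenders lt|%:R <= p.[n%:R]) :
  exists (algorithm : cmd) (q : {poly R}),
    forall (n : nat) (lt : rel 'I_n), K n lt ->
      exists (s : seq 'rV[int]_n) (t : nat),
        [/\ uniq s,
            unique (minimal_hilbert_basis (length_cone R lt))
              [fset v in s]%fset,
            computes_in algorithm (encode_order lt)
              (encode_seq (@encode_vector n) s) t
          & t%:R <= q.[n%:R] ].
Proof.
(* 4700 comes from [runs_main], and the additive 3 from [runs_computes] is absorbed because X^4 is
   positive. *)
pose c := 4703%N.
exists main_cmd, (c%:R%:P * ('X + p + 2%:R%:P) ^+ 4) => n lt Klt.
have canon := canonical_rep_exists (K_interval n lt Klt).
(* The summand 2 gives X > 1 and #|E| < X even for n = 0. *)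
pose e := enum 'I_n; pose X := (n + #|extenders lt| + 2)%N.
have X1 : (1 < X)%N by rewrite /X; lia.
have eX : (size e <= X)%N by rewrite size_enum_ord /X; lia.
have e_mem x : x \in e by rewrite mem_enum.
have fX : (#|[set S in found e lt]%SET| < X)%N.
  have -> : [set S in found e lt]%SET = extenders lt.
    by apply/setP=> S; rewrite inE (mem_found_extenders canon).
  by rewrite /X -addnA ltn_addl // addn2 ltnS leqnSn.
have [t run tX] := runs_computes (runs_main X1 eX e_mem (enum_uniq _) fX).
pose L := [seq S <- rev (found e lt) | ~~ splits (found e lt) S].
have mem_L S : (S \in L) = irreducible_extender lt S.
  by rewrite mem_filter mem_rev andbC (mem_found_extenders canon).
exists (map (@indicator n) L), t; split.
- rewrite (map_inj_uniq (@indicator_inj n)) filter_uniq // rev_uniq.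
  exact: found_uniq.
- exact: minimal_hilbert_basis_unique mem_L.
- rewrite encode_orderE encode_seq_map.
  have -> : (fun S => encode_vector (indicator S)) = encode_set e.
    by apply/funext => S; exact: encode_vector_indicator.
  exact: run.
have X4 : (0 < X ^ 4)%N by rewrite expn_gt0 ltnW.
have tc : (t <= c * X ^ 4)%N by rewrite /c; lia.
rewrite hornerM horner_exp !hornerD hornerX !hornerC.
apply: le_trans (_ : (c * X ^ 4)%N%:R <= _); first by rewrite ler_nat.
rewrite natrM natrX ler_wpM2l //; apply: lerXn2r; rewrite ?nnegrE //.
  (* Monotonicity of the fourth power needs a non-negative base: p(n) bounds a cardinality, so it is
     non-negative at this n. *)
  by rewrite !addr_ge0 // (le_trans _ (K_extenders n lt Klt)).
by rewrite /X !natrD lerD2r lerD2l K_extenders.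
Qed.
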